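(* Let $N\ge 1$ and, for each $i=1,\dots,N$, let $A_i\in\mathbb{R}^{n_i\times n_i}$, $C_i\in\mathbb{R}^{p_i\times n_i}$, $Q_i\succ 0$, $R_i\succ 0$ with $(A_i,Q_i^{1/2})$ controllable and $(A_i,C_i)$ detectable, and assume $\sum_{i=1}^Nq_i^c<1$. Consider $$\text{OP}:\quad \min_{q_1,\dots,q_N}\ \max_{i}\ \mathrm{Tr}(X_i(q_i))\quad\text{subject to}\quad \sum_{i=1}^Nq_i=1,\quad q_i^c<q_i\le1,\ i=1,\dots,N.$$ Then OP is equivalent to a quasi-convex optimization problem that can be solved by solving $$\mu(\gamma)=\sum_{i=1}^N q_i^{opt}(\gamma),\qquad q_i^{opt}(\gamma)=\min_{q_i}\{\,q_i:\ \mathrm{Tr}(X_i(q_i))\le\gamma,\ q_i^c<q_i\le1\,\},\qquad (\mathrm S)$$ using bisection on $\gamma$ until $\mu(\gamma)=1$ within the desired accuracy. For each level $\gamma$, each of the $N$ independent subproblems defining $q_i^{opt}(\gamma)$ in (S) can be solved by solving $$\min_{q_i,\,H,\,G\succ0,\,Y\succ0}\ q_i\quad\text{subject to}\quad \mathrm{Tr}(Y)\le\gamma,\ \ \begin{bmatrix}Y&I\\ I&G\end{bmatrix}\succeq0,\ \ \Gamma^{(i)}_{q_i}(G,H)\succ0,\ \ q_i^c<q_i\le1,$$ also using bisection on the variable $q_i$ and iterating linear matrix inequality (LMI) feasibility problems in $(G,H,Y)$ (for each fixed $q_i$ the constraints are LMIs in $(G,H,Y)$).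
   Context: For each $i$, $X\succeq0$ and $q\in[0,1]$, $$g_{q}(X)=A_iXA_i'+Q_i-q\,A_iXC_i'(C_iXC_i'+R_i)^{-1}C_iXA_i'$$ (the map for system $i$; $'$ denotes transpose). The critical value $q_i^c\in[0,1)$ depends on the unstable eigenvalues of $A_i$ and is the threshold such that, for $q_i\in(0,1]$, a positive semidefinite fixed point $X_i=g_{q_i}(X_i)$ exists if and only if $q_i>q_i^c$. It is known (earlier literature) that for $q_i\in(q_i^c,1]$ this fixed point, denoted $X_i(q_i)$, is unique. In the last problem $G,Y$ are symmetric $n_i\times n_i$, $H\in\mathbb{R}^{n_i\times p_i}$, and $$\Gamma^{(i)}_{q}(G,H)=\begin{bmatrix} G & \sqrt{1-q}\,GA_i & \sqrt q\,(GA_i+HC_i) & \sqrt q\,H & G\\ (\cdot)' & G&0&0&0\\ (\cdot)'&(\cdot)'&G&0&0\\ (\cdot)'&(\cdot)'&(\cdot)'&R_i^{-1}&0\\ (\cdot)'&(\cdot)'&(\cdot)'&(\cdot)'&Q_i^{-1}\end{bmatrix},$$ where $(\cdot)'$ in position $(j,l)$ stands for the transpose of the block in position $(l,j)$. Convention: if the subproblem defining $q_i^{opt}(\gamma)$ is infeasible, $q_i^{opt}(\gamma)$ is set to $1$. The equivalent form of OP is: minimize $\gamma>0$ over $(q_1,\dots,q_N,\gamma)$ subject to $\mathrm{Tr}(X_i(q_i))\le\gamma$, $\sum_iq_i=1$, $q_i^c<q_i\le 1$.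
   Formalization: Minima are infima. If Tr X_i is constant, the LMI value is not claimed equal to q_i^opt at γ equal to that constant, nor that μ reaches 1 (A=0, C=Q=R=1, γ=1 fails). The μ≈1 accuracy and optimality claims need feasible subproblems; optimality of q^opt also needs q_i^opt>q_i^c. *)

(* Defs.v *)
From HB Require Import structures.
From mathcomp Require Import all_boot all_order all_algebra.
From mathcomp Require Import boolp classical_sets reals topology normedtype.
From mathcomp Require Import sequences convex.
From mathcomp Require Import complex.
Set Implicit Arguments.
Unset Strict Implicit.
Unset Printing Implicit Defensive.
Import Order.TTheory GRing.Theory Num.Theory.
Import numFieldNormedType.Exports.
Local Open Scope classical_set_scope.
Local Open Scope ring_scope.

Section Matrices.
Context {R : realType}.

Definition psd n (M : 'M[R]_n) : Prop :=
  M^T = M /\ forall x : 'cV[R]_n, 0 <= (x^T *m M *m x) 0 0.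

Definition pd n (M : 'M[R]_n) : Prop :=
  M^T = M /\ forall x : 'cV[R]_n, x != 0 -> 0 < (x^T *m M *m x) 0 0.

(* The square root of a positive semidefinite matrix is the unique positive
   semidefinite matrix in the set below. *)
Definition mxsqrt n (Q : 'M[R]_n) : 'M[R]_n :=
  xget 0 [set S : 'M[R]_n | psd S /\ S *m S = Q].

(* Full rank of the controllability matrix [B, A B, ..., A^(n-1) B]. *)
Definition controllable n m (A : 'M[R]_n) (B : 'M[R]_(n, m)) : Prop :=
  \rank (\mxrow_(k < n) (A ^+ k *m B)) = n.

Definition schur_stable n (A : 'M[R]_n) : Prop :=
  forall z : R[i], eigenvalue (map_mx (real_complex R) A) z -> `|z| < 1.

Definition detectable n p (A : 'M[R]_n) (C : 'M[R]_(p, n)) : Prop :=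
  exists L : 'M[R]_(n, p), schur_stable (A - L *m C).

End Matrices.

Section Optimization.
Context {R : realType}.

Definition is_minimizer (T : Type) (D : set T) (f : T -> R) (x : T) : Prop :=
  D x /\ forall y, D y -> f x <= f y.

Definition quasiconvex_problem (T : lmodType R) (D : set T) (f : T -> R) : Prop :=
  convex_set D /\ forall c : R, convex_set [set x | D x /\ f x <= c].

Definition is_affine (U V : lmodType R) (f : U -> V) : Prop :=
  forall (t : R) (x y : U),
    f (t *: x + (1 - t) *: y) = t *: f x + (1 - t) *: f y.

(* Optimal value of "minimize q over D", an infeasible problem being given the
   value 1.  The minimum is read as an infimum, since D need not contain it. *)
Definition min_or1 (D : set R) : R := if `[< D !=set0 >] then inf D else 1.

Definition bisection_step (P : R -> bool) (lu : R * R) : R * R :=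
  let m := (lu.1 + lu.2) / 2 in if P m then (lu.1, m) else (m, lu.2).

(* The bracket [l, u] after k halvings; P is expected to fail to the left and
   to hold to the right of the sought point. *)
Definition bisection (P : R -> bool) (l u : R) (k : nat) : R * R :=
  iter k (bisection_step P) (l, u).

End Optimization.

(* A single system.  V is the measurement noise covariance R_i, the letter R
   being the field of reals. *)
Section System.
Context {R : realType} {n p : nat}.
Variables (A : 'M[R]_n) (C : 'M[R]_(p, n)) (Q : 'M[R]_n) (V : 'M[R]_p).

Definition riccati (q : R) (X : 'M[R]_n) : 'M[R]_n :=
  A *m X *m A^T + Q -
  q *: (A *m X *m C^T *m invmx (C *m X *m C^T + V) *m C *m X *m A^T).

Definition riccati_fixpoint (q : R) : set 'M[R]_n :=
  [set X | psd X /\ X = riccati q X].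

Definition is_critical_value (qc : R) : Prop :=
  0 <= qc < 1 /\
  forall q, 0 < q <= 1 -> (riccati_fixpoint q !=set0 <-> qc < q).

(* The positive semidefinite fixed point X(q), which exists and is unique for
   qc < q <= 1; the default value 0 is irrelevant there. *)
Definition Xfix (q : R) : 'M[R]_n := xget 0 (riccati_fixpoint q).

Definition Gamma (q : R) (G : 'M[R]_n) (H : 'M[R]_(n, p)) :
    'M[R]_(n + (n + (n + (p + n)))) :=
  let G2 := Num.sqrt (1 - q) *: (G *m A) in
  let G3 := Num.sqrt q *: (G *m A + H *m C) in
  let G4 := Num.sqrt q *: H in
  block_mx
    G (row_mx G2 (row_mx G3 (row_mx G4 G)))
    (col_mx G2^T (col_mx G3^T (col_mx G4^T G^T)))
    (block_mx G 0 0 (block_mx G 0 0 (block_mx (invmx V) 0 0 (invmx Q)))).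

Definition coupling (G Y : 'M[R]_n) : 'M[R]_(n + n) := block_mx Y 1%:M 1%:M G.

Variable qc : R.

Definition sub_feasible (gamma : R) : set R :=
  [set q | \tr (Xfix q) <= gamma /\ qc < q <= 1].

Definition qopt (gamma : R) : R := min_or1 (sub_feasible gamma).

Definition lmi_constraints (gamma q : R) (G : 'M[R]_n) (H : 'M[R]_(n, p))
    (Y : 'M[R]_n) : Prop :=
  [/\ pd G, pd Y, \tr Y <= gamma, psd (coupling G Y) & pd (Gamma q G H)].

Definition lmi_feasible (gamma q : R) : Prop :=
  exists G H Y, lmi_constraints gamma q G H Y.

Definition qlmi (gamma : R) : R :=
  min_or1 [set q | lmi_feasible gamma q /\ qc < q <= 1].

Definition trace_nonconstant : Prop :=
  exists2 q, qc < q <= 1 & \tr (Xfix q) != \tr (Xfix 1).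

End System.

Section Problem.
Context {R : realType} {N : nat} {n p : 'I_N -> nat}.
Variables (A : forall i, 'M[R]_(n i)) (C : forall i, 'M[R]_(p i, n i)).
Variables (Q : forall i, 'M[R]_(n i)) (V : forall i, 'M[R]_(p i)).
Variable qc : 'I_N -> R.

Definition trX (i : 'I_N) (q : R) : R := \tr (Xfix (A i) (C i) (Q i) (V i) q).

Definition OP_feasible : set 'rV[R]_N :=
  [set q | \sum_i q 0 i = 1 /\ forall i, qc i < q 0 i <= 1].

(* The traces are nonnegative on the feasible set, so that 0 is a neutral
   element for the maximum. *)
Definition OP_objective (q : 'rV[R]_N) : R :=
  \big[Num.max/0]_i trX i (q 0 i).

Definition OP_value : R := inf (OP_objective @` OP_feasible).

Definition level_feasible : set ('rV[R]_N * R) :=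
  [set z : 'rV[R]_N * R |
           [/\ 0 < z.2, forall i, trX i (z.1 0 i) <= z.2,
               \sum_i z.1 0 i = 1 & forall i, qc i < z.1 0 i <= 1]].

Definition qopt_vec (gamma : R) : 'rV[R]_N :=
  \row_i qopt (A i) (C i) (Q i) (V i) (qc i) gamma.

Definition mu (gamma : R) : R := \sum_i qopt_vec gamma 0 i.

Definition all_sub_feasible (gamma : R) : Prop :=
  forall i, sub_feasible (A i) (C i) (Q i) (V i) (qc i) gamma !=set0.

Definition mu_bisection (l u : R) (k : nat) : R * R :=
  bisection (fun gamma => mu gamma < 1) l u k.

End Problem.

Section SubproblemBisection.
Context {R : realType} {n p : nat}.
Variables (A : 'M[R]_n) (C : 'M[R]_(p, n)) (Q : 'M[R]_n) (V : 'M[R]_p).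

Definition lmi_bisection (qc gamma : R) (k : nat) : R * R :=
  bisection (fun q => `[< lmi_feasible A C Q V gamma q >]) qc 1 k.

End SubproblemBisection.

(* Main.v *)
Require Import Defs.
From HB Require Import structures.
From mathcomp Require Import all_boot all_order all_algebra.
From mathcomp Require Import boolp classical_sets reals topology normedtype.
From mathcomp Require Import sequences convex.
From mathcomp Require Import complex.
From mathcomp Require Import interval_inference ring lra.
Set Implicit Arguments.
Unset Strict Implicit.
Unset Printing Implicit Defensive.
Import Order.TTheory GRing.Theory Num.Theory.
Import numFieldNormedType.Exports.
Local Open Scope classical_set_scope.
Local Open Scope ring_scope.

(** For one system write [g_q] for the Riccati map.  Completing the square in
    the gain ([gain_updateE]) shows that [g_q X] is the minimum over all gains
    of updates that are affine and monotone in [X].  Hence [g_q] is monotone and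
    concave, it is at least [Q] at the origin, and it decreases with [q].  For
    a concave monotone map that is positive at the origin, a fixed point lies
    below every supersolution ([fixpoint_le_super]): this gives uniqueness of
    [X(q)], the fact that [X(q)] decreases with [q], and the comparison with
    solutions of matrix inequalities.  Moreover [(1 + e) X(q)] is a
    supersolution with slack [e Q], since [Q] is positive definite.  This slack
    pays for a small decrease of [q] ([Xfix_le_scale]), so [q |-> tr X(q)] is
    continuous, and it turns the fixed point into a strict supersolution
    ([trace_lmi]).  Finally, if [tr X(q) = tr X(q')] for some [q < q'], then the
    term of the Riccati map that depends on [q] vanishes at this common fixed
    point, and [X] is constant ([trace_Xfix_rigid]).

    By a Schur complement ([pd_Gamma]), the constraint on [Gamma] says that
    [G^-1] is a strict supersolution for the gain [G^-1 H].  So the matrix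
    inequalities at level [gamma] are feasible if [tr X(q) < gamma] and only if
    [tr X(q) <= gamma].  By rigidity the two optimal values can then only differ
    when the trace is constant and equal to [gamma] ([qlmi_qopt]).

    The optimization problem only sees the functions [tr X_i(q)] through the
    properties collected in [tradeoff].  Antitone functions of one variable are
    quasi-convex, and so is their maximum.  The minimal parameter [level_min] is
    the generalized inverse of such a function, and [total_min], the sum of
    these inverses, decreases with [gamma].  It is below [1] exactly when
    shares summing to [1] are left strictly above the minimal ones, which
    places the optimal value between the levels where [total_min] is at least
    [1] and those where it is below ([opt_ge_of_total], [opt_le_of_total]), and
    this is what bisection exploits. *)

(** * Quadratic forms and Schur complements *)

Section QuadraticForms.
Context {R : realType}.

Definition qform n (M : 'M[R]_n) (x : 'cV[R]_n) : R := (x^T *m M *m x) 0 0.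

(** The order of the forms alone: symmetry is carried separately, so that
    comparing matrices is comparing real numbers at each vector. *)
Definition loewner n (X Y : 'M[R]_n) : Prop := forall x, qform X x <= qform Y x.

Lemma addmxE n m (X Y : 'M[R]_(n, m)) i j : (X + Y) i j = X i j + Y i j.
Proof. by rewrite mxE. Qed.

Lemma oppmxE n m (X : 'M[R]_(n, m)) i j : (- X) i j = - X i j.
Proof. by rewrite mxE. Qed.

Lemma scalemxE n m a (X : 'M[R]_(n, m)) i j : (a *: X) i j = a * X i j.
Proof. by rewrite mxE. Qed.

Lemma trmxE n m (X : 'M[R]_(n, m)) i j : X^T i j = X j i.
Proof. by rewrite mxE. Qed.

Lemma qformD n (M P : 'M[R]_n) x : qform (M + P) x = qform M x + qform P x.
Proof. by rewrite /qform mulmxDr mulmxDl mxE. Qed.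

Lemma qformZ n a (M : 'M[R]_n) x : qform (a *: M) x = a * qform M x.
Proof. by rewrite /qform -scalemxAr -scalemxAl mxE. Qed.

Lemma qformB n (M P : 'M[R]_n) x : qform (M - P) x = qform M x - qform P x.
Proof. by rewrite -scaleN1r qformD qformZ mulN1r. Qed.

Lemma qform0r n (M : 'M[R]_n) : qform M 0 = 0.
Proof. by rewrite /qform mulmx0 mxE. Qed.

Lemma qformZr n a (M : 'M[R]_n) x : qform M (a *: x) = a ^+ 2 * qform M x.
Proof.
by rewrite /qform [(_ *: _)^T]linearZ /= -!scalemxAl -scalemxAr scalerA mxE expr2.
Qed.

Lemma qform_congr n m (B : 'M[R]_(n, m)) (M : 'M[R]_m) x :
  qform (B *m M *m B^T) x = qform M (B^T *m x).
Proof. by rewrite /qform trmx_mul trmxK !mulmxA. Qed.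

Lemma bilin_sym n (M : 'M[R]_n) (x y : 'cV[R]_n) : M^T = M ->
  (y^T *m M *m x) 0 0 = (x^T *m M *m y) 0 0.
Proof.
move=> Msym.
have -> : y^T *m M *m x = (x^T *m M *m y)^T.
  by rewrite !trmx_mul trmxK Msym mulmxA.
by rewrite mxE.
Qed.

Lemma qform_add n (M : 'M[R]_n) x y : M^T = M ->
  qform M (x + y) = qform M x + 2 * (x^T *m M *m y) 0 0 + qform M y.
Proof.
move=> Msym; rewrite /qform [(_ + _)^T]linearD /= !mulmxDl !mulmxDr !addmxE.
by rewrite (bilin_sym x y Msym) -!/(qform _ _); ring.
Qed.

Lemma qform_delta n (M : 'M[R]_n) i : qform M (delta_mx i 0) = M i i.
Proof. by rewrite /qform trmx_delta -rowE -colE !mxE. Qed.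

Lemma qform_delta2 n (M : 'M[R]_n) i j a : M^T = M ->
  qform M (delta_mx i 0 + a *: delta_mx j 0) =
  M i i + 2 * a * M i j + a ^+ 2 * M j j.
Proof.
move=> Msym; rewrite qform_add // qformZr !qform_delta -scalemxAr scalemxE.
by rewrite trmx_delta -rowE -colE !mxE; ring.
Qed.

Lemma mxtrace_le n (X Y : 'M[R]_n) : loewner X Y -> \tr X <= \tr Y.
Proof. by move=> XY; apply: ler_sum => i _; rewrite -!qform_delta. Qed.

Lemma qform_inj n (X Y : 'M[R]_n) :
  X^T = X -> Y^T = Y -> qform X =1 qform Y -> X = Y.
Proof.
move=> Xs Ys XY; apply/matrixP => i j.
have := XY (delta_mx i 0 + 1 *: delta_mx j 0).
have := XY (delta_mx i 0); have := XY (delta_mx j 0).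
by rewrite !qform_delta2 // !qform_delta; lra.
Qed.

(** The form of [Y - X] is nonnegative with zero diagonal; its values at
    [e_i + e_j] and [e_i - e_j] then force the other entries to vanish. *)
Lemma mxtrace_inj n (X Y : 'M[R]_n) :
  X^T = X -> Y^T = Y -> loewner X Y -> \tr X = \tr Y -> X = Y.
Proof.
move=> Xs Ys XY trXY; have diag i : X i i = Y i i.
  have /eqP : \sum_i (Y i i - X i i) = 0.
    by rewrite sumrB; apply/eqP; rewrite subr_eq0 -/(mxtrace _) -/(mxtrace X) trXY.
  rewrite psumr_eq0; last by move=> j _; rewrite subr_ge0 -!qform_delta.
  by move=> /allP/(_ i (mem_index_enum _))/=; rewrite subr_eq0 => /eqP.
apply/matrixP => i j.
have := XY (delta_mx i 0 + 1 *: delta_mx j 0).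
have := XY (delta_mx i 0 + (-1) *: delta_mx j 0).
by rewrite !qform_delta2 // !diag; lra.
Qed.

Lemma pd_unitmx n (M : 'M[R]_n) : pd M -> M \in unitmx.
Proof.
move=> [Msym Mpos]; rewrite -row_free_unit -kermx_eq0.
apply/eqP/row_matrixP => i; rewrite row0.
set v := row i _; have [//|vN0] := eqVneq v 0.
have vT : v^T != 0 by rewrite -trmx0 (inj_eq trmx_inj).
have := Mpos _ vT; rewrite trmxK.
have -> : v *m M = 0 by rewrite /v -row_mul mulmx_ker row0.
by rewrite mul0mx mxE ltxx.
Qed.

Lemma pd_ge0 n (M : 'M[R]_n) x : pd M -> 0 <= qform M x.
Proof.
move=> [_ Mpos]; have [->|/Mpos/ltW//] := eqVneq x 0.
by rewrite qform0r.
Qed.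

Lemma psd_ge0 m (M : 'M[R]_m) x : psd M -> 0 <= qform M x.
Proof. by case=> _; apply. Qed.

Lemma psdZ m a (M : 'M[R]_m) : 0 <= a -> psd M -> psd (a *: M).
Proof.
move=> a0 [Ms Mp]; split=> [|x]; first by rewrite linearZ /= Ms.
by rewrite -/(qform _ _) qformZ; apply: mulr_ge0 => //; exact: Mp.
Qed.

Lemma pd_psd m (M : 'M[R]_m) : pd M -> psd M.
Proof. by move=> Mpd; split=> [|x]; [case: Mpd | exact: pd_ge0]. Qed.

Lemma pd_inv n (M : 'M[R]_n) : pd M -> pd (invmx M).
Proof.
move=> Mpd; have Mu := pd_unitmx Mpd; have [Msym Mpos] := Mpd.
have Vsym : (invmx M)^T = invmx M by rewrite trmx_inv Msym.
split => // x xN0; rewrite -/(qform _ _).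
have -> : invmx M = invmx M *m M *m (invmx M)^T by rewrite Vsym mulVmx // mul1mx.
rewrite qform_congr; apply: Mpos; apply: contraNneq xN0 => /(congr1 (mulmx M)).
by rewrite Vsym mulKVmx // mulmx0 => ->.
Qed.

(** Cauchy-Schwarz: with [d] the diagonal entry of [M^-1], the form is
    nonnegative at [x - (x_i / d) M^-1 e_i], where it equals
    [qform M x - x_i^2 / d]. *)
Lemma pd_coord_le n (M : 'M[R]_n) (x : 'cV[R]_n) i : pd M ->
  x i 0 ^+ 2 <= invmx M i i * qform M x.
Proof.
move=> Mpd; have Mu := pd_unitmx Mpd; have [Msym _] := Mpd.
have Vsym : (invmx M)^T = invmx M by rewrite trmx_inv Msym.
pose e : 'cV[R]_n := delta_mx i 0; pose d : R := invmx M i i.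
have d0 : 0 < d.
  rewrite /d -qform_delta; apply: (pd_inv Mpd).2.
  by apply/eqP => /matrixP/(_ i 0)/eqP; rewrite !mxE !eqxx oner_eq0.
have := pd_ge0 (x + (- (x i 0 / d)) *: (invmx M *m e)) Mpd.
rewrite qform_add // qformZr -scalemxAr scalemxE.
rewrite -mulmxA mulKVmx // -colE !mxE.
have -> : qform M (invmx M *m e) = d.
  by rewrite -Vsym -qform_congr Vsym mulVmx // mul1mx qform_delta.
set y : R := x i 0; set f : R := qform M x => h.
have : 0 <= f - y ^+ 2 / d.
  apply: le_trans h _; rewrite le_eqVlt; apply/orP; left; apply/eqP.
  by field; rewrite lt0r_neq0.
by rewrite subr_ge0 ler_pdivrMr // mulrC.
Qed.

(** By [pd_coord_le], every product [x_i x_j] is at most [s * qform M x], where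
    [s] is the trace of [M^-1]; summing against the entries of [P] bounds
    [qform P]. *)
Lemma pd_dominates n (M P : 'M[R]_n) : pd M ->
  exists2 c, 0 < c & loewner (c *: P) M.
Proof.
move=> Mpd.
pose s := \sum_i invmx M i i; pose t := \sum_j \sum_i `|P i j|.
have Vpos i : 0 <= invmx M i i by rewrite -qform_delta; apply/pd_ge0/pd_inv.
have s0 : 0 <= s by apply: sumr_ge0.
have t0 : 0 <= t by apply: sumr_ge0 => i _; apply: sumr_ge0.
have coord (x : 'cV[R]_n) i : x i 0 ^+ 2 <= s * qform M x.
  apply: le_trans (pd_coord_le x i Mpd) _; apply: ler_wpM2r; first exact: pd_ge0.
  by rewrite /s (bigD1 i) //= lerDl sumr_ge0.
have bound x : qform P x <= t * (s * qform M x).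
  rewrite /qform mxE /t mulr_suml -/(qform M x); apply: ler_sum => j _.
  rewrite [X in X * _]mxE [leLHS]mulr_suml [leRHS]mulr_suml.
  apply: ler_sum => i _; rewrite trmxE.
  apply: le_trans (ler_norm _) _; rewrite mulrAC !normrM mulrC.
  apply: ler_wpM2l => //.
  have := coord x i; have := coord x j.
  have := sqr_ge0 (`|x i 0| - `|x j 0|).
  rewrite -(real_normK (num_real (x i 0))) -(real_normK (num_real (x j 0))).
  by nra.
exists (t * s + 1)^-1; first by rewrite invr_gt0; nra.
move=> x; rewrite qformZ ler_pdivrMl; last by nra.
by apply: le_trans (bound x) _; have := pd_ge0 x Mpd; nra.
Qed.

Lemma qform_block n m (a : 'M[R]_n) (b : 'M[R]_(n, m)) (d : 'M[R]_m) y z :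
  qform (block_mx a b b^T d) (col_mx y z) =
  qform a y + 2 * (y^T *m b *m z) 0 0 + qform d z.
Proof.
have tr_eq : z^T *m b^T *m y = (y^T *m b *m z)^T.
  by rewrite !trmx_mul trmxK mulmxA.
rewrite /qform tr_col_mx mul_row_block mul_row_col !mulmxDl tr_eq.
rewrite !addmxE trmxE -!/(qform _ _); ring.
Qed.

Lemma qform_block_diag n m (a : 'M[R]_n) (d : 'M[R]_m) y z :
  qform (block_mx a 0 0 d) (col_mx y z) = qform a y + qform d z.
Proof. by rewrite -(trmx0 _ n m) qform_block mulmx0 mul0mx mxE mulr0 addr0. Qed.

(** Completing the square in the second variable. *)
Lemma qform_schur n m (a : 'M[R]_n) (b : 'M[R]_(n, m)) (d e : 'M[R]_m) y z :
  d^T = d -> e^T = e -> d *m e = 1%:M ->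
  qform (block_mx a b b^T d) (col_mx y z) =
  qform a y - qform e (b^T *m y) + qform d (z + e *m (b^T *m y)).
Proof.
move=> ds es de; rewrite qform_block qform_add //.
set w := b^T *m y.
have -> : qform d (e *m w) = qform e w.
  by rewrite -{1}es -qform_congr es (mulmx1C de) mul1mx.
have -> : z^T *m d *m (e *m w) = (y^T *m b *m z)^T.
  by rewrite mulmxA -(mulmxA _ d) de mulmx1 /w !trmx_mul trmxK mulmxA.
by rewrite trmxE; ring.
Qed.

Lemma pd_block_diag n m (a : 'M[R]_n) (d : 'M[R]_m) :
  pd a -> pd d -> pd (block_mx a 0 0 d).
Proof.
move=> apd dpd; split.
  by rewrite tr_block_mx !trmx0 apd.1 dpd.1.
move=> x; rewrite -/(qform _ _) -[x]vsubmxK qform_block_diag.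
set y := usubmx x; set z := dsubmx x.
have := pd_ge0 y apd; have := pd_ge0 z dpd.
have [->|yN0 z0 y0 _] := eqVneq y 0; last first.
  have := apd.2 _ yN0; rewrite -/(qform _ _); lra.
rewrite col_mx_eq0 eqxx /= => z0 y0 zN0.
have := dpd.2 _ zN0; rewrite -/(qform _ _); lra.
Qed.

(** The minimum over the second variable is at [z = - e b^T y].  The inverse [e]
    of [d] is an argument because a block diagonal [d] has an evident one. *)
Lemma pd_schur n m (a : 'M[R]_n) (b : 'M[R]_(n, m)) (d e : 'M[R]_m) :
  a^T = a -> pd d -> e^T = e -> d *m e = 1%:M ->
  pd (block_mx a b b^T d) <->
  (forall y, y != 0 -> qform e (b^T *m y) < qform a y).
Proof.
move=> asym dpd es de; split=> [[_ Bpos] y yN0|schur].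
  have := Bpos (col_mx y (- (e *m (b^T *m y)))).
  rewrite -/(qform _ _) (qform_schur _ _ _ _ dpd.1 es de) addNr qform0r addr0.
  by rewrite subr_gt0; apply; rewrite col_mx_eq0 (negbTE yN0).
split; first by rewrite tr_block_mx trmxK asym dpd.1.
move=> x; rewrite -/(qform _ _) -[x]vsubmxK (qform_schur _ _ _ _ dpd.1 es de).
set y := usubmx x; set z := dsubmx x.
have := pd_ge0 (z + e *m (b^T *m y)) dpd.
have [->|yN0 z0 _] := eqVneq y 0; last first.
  have := schur _ yN0; lra.
rewrite col_mx_eq0 eqxx /= !mulmx0 addr0 !qform0r subrr add0r => _ zN0.
exact: dpd.2.
Qed.

End QuadraticForms.

(** * The Riccati map and its fixed points *)

Section Riccati.
Context {R : realType} {n p : nat}.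
Context (A : 'M[R]_n) (C : 'M[R]_(p, n)) (Q : 'M[R]_n) (V : 'M[R]_p).
Context (Q_pd : pd Q) (V_pd : pd V).

(** The covariance update of an estimator with the arbitrary gain [K], when the
    measurement is received with probability [q]. *)
Definition gain_update (q : R) (K : 'M[R]_(n, p)) (X : 'M[R]_n) : 'M[R]_n :=
  (1 - q) *: (A *m X *m A^T) +
  q *: ((A + K *m C) *m X *m (A + K *m C)^T + K *m V *m K^T) + Q.

Definition innov (X : 'M[R]_n) : 'M[R]_p := C *m X *m C^T + V.

Definition opt_gain (X : 'M[R]_n) : 'M[R]_(n, p) :=
  - (A *m X *m C^T *m invmx (innov X)).

Definition correction (X : 'M[R]_n) : 'M[R]_n :=
  A *m X *m C^T *m invmx (innov X) *m C *m X *m A^T.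

Lemma riccatiE q X :
  riccati A C Q V q X = A *m X *m A^T + Q - q *: correction X.
Proof. by []. Qed.

Lemma qform_riccati q X x : qform (riccati A C Q V q X) x =
  qform X (A^T *m x) + qform Q x - q * qform (correction X) x.
Proof. by rewrite riccatiE qformB qformD qform_congr qformZ. Qed.

Lemma qform_gain_update q K X x : qform (gain_update q K X) x =
  (1 - q) * qform X (A^T *m x) +
  q * (qform X ((A + K *m C)^T *m x) + qform V (K^T *m x)) + qform Q x.
Proof. by rewrite /gain_update !(qformD, qformZ) !qform_congr. Qed.

Lemma innov_pd X : psd X -> pd (innov X).
Proof.
move=> Xpsd; split.
  by rewrite /innov linearD /= !trmx_mul trmxK Xpsd.1 V_pd.1 mulmxA.
move=> x xN0; rewrite -/(qform _ _) qformD qform_congr.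
by apply: ltr_wpDl; [exact: psd_ge0 | exact: V_pd.2].
Qed.

Lemma riccati_sym q X : psd X -> (riccati A C Q V q X)^T = riccati A C Q V q X.
Proof.
move=> Xpsd; have [Ws _] := innov_pd Xpsd.
rewrite riccatiE /correction linearB linearD linearZ /=.
by rewrite !trmx_mul !trmxK trmx_inv Ws Xpsd.1 Q_pd.1 !mulmxA.
Qed.

(** Completing the square in the gain: the Riccati map is the minimum over [K]
    of maps that are affine and monotone in [X], hence it is concave and
    monotone. *)
Lemma gain_updateE q K X : psd X ->
  gain_update q K X = riccati A C Q V q X +
    q *: ((K - opt_gain X) *m innov X *m (K - opt_gain X)^T).
Proof.
move=> Xpsd; have := innov_pd Xpsd; set W := innov X => Wpd.
have Wu := pd_unitmx Wpd; pose U := A *m X *m C^T.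
have CXC : C *m X *m C^T = W - V by rewrite /W /innov addrK.
have UT : U^T = C *m X *m A^T by rewrite /U !trmx_mul trmxK Xpsd.1 mulmxA.
have DE : correction X = U *m invmx W *m U^T by rewrite UT !mulmxA.
have KE : K - opt_gain X = K + U *m invmx W by rewrite /opt_gain opprK.
have KET : (K - opt_gain X)^T = K^T + invmx W *m U^T.
  by rewrite KE linearD /= trmx_mul trmx_inv Wpd.1.
move: W Wpd Wu CXC DE KE KET => W Wpd Wu CXC DE KE KET.
have lhs : (A + K *m C) *m X *m (A + K *m C)^T =
    A *m X *m A^T + U *m K^T + (K *m U^T + K *m (W - V) *m K^T).
  rewrite UT -CXC /U linearD /= trmx_mul.
  by rewrite !mulmxDl !mulmxDr !mulmxA.
have rhs : (K - opt_gain X) *m W *m (K - opt_gain X)^T =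
    K *m W *m K^T + U *m K^T + (K *m U^T + correction X).
  rewrite KET KE DE mulmxDl mulmxKV // mulmxDl !mulmxDr !mulmxA.
  by rewrite mulmxK // addrACA [_ *m U^T + _]addrC addrACA.
rewrite /gain_update riccatiE rhs lhs mulmxBr mulmxBl.
move: (correction X) => Y; apply/matrixP => i j.
by rewrite !(addmxE, scalemxE, oppmxE); ring.
Qed.

Lemma gain_update_opt q X : psd X ->
  gain_update q (opt_gain X) X = riccati A C Q V q X.
Proof. by move=> Xpsd; rewrite gain_updateE // subrr !mul0mx scaler0 addr0. Qed.

Lemma riccati_le_gain q K X : psd X -> 0 <= q ->
  loewner (riccati A C Q V q X) (gain_update q K X).
Proof.
move=> Xpsd q0 x; rewrite gain_updateE // qformD qformZ qform_congr.
by rewrite lerDl mulr_ge0 // pd_ge0 //; exact: innov_pd.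
Qed.

Lemma gain_update_mono q K X Z : 0 <= q <= 1 -> loewner X Z ->
  loewner (gain_update q K X) (gain_update q K Z).
Proof.
move=> /andP[q0 q1] XZ x; rewrite !qform_gain_update lerD2r.
by apply: lerD; apply: ler_wpM2l; rewrite ?subr_ge0 ?lerD2r //; exact: XZ.
Qed.

(** For a fixed gain the update is affine in [X], and its value at [X = 0] is
    [Q + q K V K^T], which is above [Q]. *)
Lemma gain_update_scale q K X t x : 0 <= q -> t <= 1 ->
  t * qform (gain_update q K X) x + (1 - t) * qform Q x <=
  qform (gain_update q K (t *: X)) x.
Proof.
move=> q0 t1; rewrite !qform_gain_update !qformZ -subr_ge0.
rewrite [leRHS](_ : _ = q * (1 - t) * qform V (K^T *m x)); last by ring.
by rewrite !mulr_ge0 ?subr_ge0 // pd_ge0.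
Qed.

(** The optimal gain for [Z] is one of the gains allowed for [X]. *)
Lemma riccati_mono q X Z : 0 <= q <= 1 -> psd X -> psd Z -> loewner X Z ->
  loewner (riccati A C Q V q X) (riccati A C Q V q Z).
Proof.
move=> q01 Xpsd Zpsd XZ x; rewrite -(gain_update_opt q Zpsd).
apply: le_trans (gain_update_mono (opt_gain Z) q01 XZ x).
by apply: riccati_le_gain => //; case/andP: q01.
Qed.

(** Concavity between [X] and the origin, where the map is at least [Q]. *)
Lemma riccati_scale q X t x : 0 <= q -> 0 <= t <= 1 -> psd X ->
  t * qform (riccati A C Q V q X) x + (1 - t) * qform Q x <=
  qform (riccati A C Q V q (t *: X)) x.
Proof.
move=> q0 /andP[t0 t1] Xpsd; have tXpsd := psdZ t0 Xpsd.
rewrite -(gain_update_opt q tXpsd).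
apply: le_trans (gain_update_scale (opt_gain (t *: X)) X x q0 t1).
by rewrite lerD2r; apply: ler_wpM2l => //; exact: riccati_le_gain.
Qed.

(** This is [riccati_scale] at [(1 + e) X] with [t = 1 / (1 + e)]: enlarging a
    fixed point yields a supersolution with slack [e Q]. *)
Lemma riccati_expand q X e x : 0 <= q -> 0 <= e -> psd X ->
  qform (riccati A C Q V q ((1 + e) *: X)) x + e * qform Q x <=
  (1 + e) * qform (riccati A C Q V q X) x.
Proof.
move=> q0 e0 Xpsd; have e1 : 0 < 1 + e by lra.
have i0 : 0 < (1 + e)^-1 by rewrite invr_gt0.
have i01 : 0 <= (1 + e)^-1 <= 1 by rewrite ltW //= invf_le1 ?lerDl.
have Zpsd := psdZ (ltW e1) Xpsd.
have := riccati_scale x q0 i01 Zpsd; rewrite scalerA mulVf ?scale1r ?gt_eqF //.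
rewrite -(ler_pM2l e1); apply: le_trans; rewrite le_eqVlt; apply/orP; left.
by apply/eqP; field; rewrite gt_eqF.
Qed.

Lemma riccati_geQ q X : 0 <= q <= 1 -> psd X ->
  loewner Q (riccati A C Q V q X).
Proof.
move=> /andP[q0 q1] Xpsd x; rewrite -(gain_update_opt q Xpsd) qform_gain_update.
rewrite lerDr addr_ge0 // mulr_ge0 ?subr_ge0 // ?(psd_ge0 _ Xpsd) //.
by rewrite addr_ge0 // ?(psd_ge0 _ Xpsd) ?(pd_ge0 _ V_pd).
Qed.

Lemma correction_ge0 X x : psd X -> 0 <= qform (correction X) x.
Proof.
move=> Xpsd; have := riccati_le_gain 0 Xpsd ler01 x.
by rewrite qform_riccati qform_gain_update mul0mx addr0 trmx0 mul0mx qform0r; lra.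
Qed.

Lemma correction_le X x : psd X -> qform (correction X) x <= qform X (A^T *m x).
Proof.
move=> Xpsd; have := riccati_geQ (q := 1) _ Xpsd x.
by rewrite ler01 lexx qform_riccati => /(_ isT); lra.
Qed.

Lemma riccati_anti q q' X : psd X -> q <= q' ->
  loewner (riccati A C Q V q' X) (riccati A C Q V q X).
Proof.
move=> Xpsd qq' x; rewrite !qform_riccati.
by have := correction_ge0 x Xpsd; nra.
Qed.

(** A supersolution [Z] satisfies [Z >= t X] for [t = 0], and [Z >= t X] gives
    [Z >= g (t X) >= t X + (1 - t) Q], which reduces [1 - t] by a factor [1 - c]
    as soon as [c X <= Q].  Iterating, [t] tends to [1]. *)
Lemma fixpoint_le_super q X Z : 0 <= q <= 1 ->
  riccati_fixpoint A C Q V q X -> psd Z -> loewner (riccati A C Q V q Z) Z ->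
  loewner X Z.
Proof.
move=> q01 [Xpsd Xfx] Zpsd Zsup; have [q0 q1] := andP q01.
have [c0 c0gt0 c0X] := pd_dominates X Q_pd.
pose c := Num.min c0 2^-1.
have cgt0 : 0 < c by rewrite lt_min c0gt0 invr_gt0 ltr0n.
have c1 : c < 1 by rewrite gt_min invf_lt1 // ltr1n orbT.
have cX x : c * qform X x <= qform Q x.
  apply: le_trans (c0X x); rewrite qformZ; apply: ler_wpM2r; first exact: psd_ge0.
  by rewrite ge_min lexx.
have step k : loewner ((1 - (1 - c) ^+ k) *: X) Z.
  elim: k => [|k IH] x.
    by rewrite expr0 subrr qformZ mul0r psd_ge0.
  have r0 : 0 <= (1 - c) ^+ k by rewrite exprn_ge0 // subr_ge0 ltW.
  have r1 : (1 - c) ^+ k <= 1 by rewrite exprn_ile1 // ?subr_ge0 ?gerBl ltW.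
  set r := (1 - c) ^+ k in IH r0 r1.
  have t01 : 0 <= 1 - r <= 1 by rewrite subr_ge0 r1 gerBl.
  have tpsd : psd ((1 - r) *: X) by apply: psdZ; case/andP: t01.
  apply: le_trans (Zsup x); apply: le_trans (riccati_mono q01 tpsd Zpsd IH x).
  apply: le_trans (riccati_scale x q0 t01 Xpsd).
  by rewrite -Xfx exprS -/r qformZ; have := cX x; nra.
move=> x; rewrite leNgt; apply/negP => ZX.
have X0 : 0 < qform X x by apply: le_lt_trans ZX; exact: psd_ge0.
have /cvg_expr/cvgr0_norm_lt : `|1 - c| < 1.
  by rewrite ger0_norm ?subr_ge0 ?ltW // gtrBl.
have e0 : 0 < (qform X x - qform Z x) / qform X x by rewrite divr_gt0 ?subr_gt0.
move=> /(_ _ e0)[k _ /(_ k (leqnn k))/=].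
rewrite ger0_norm ?exprn_ge0 ?subr_ge0 ?ltW // ltr_pdivlMr //.
by have := step k x; rewrite qformZ; lra.
Qed.

Context (qc : R) (crit : is_critical_value A C Q V qc).

Local Notation X := (Xfix A C Q V).

Lemma Xfix_fixpoint q : qc < q <= 1 -> riccati_fixpoint A C Q V q (X q).
Proof.
move=> /andP[qcq q1]; have [/andP[qc0 qc1] ex_fix] := crit.
have q01 : 0 < q <= 1 by rewrite q1 andbT (le_lt_trans qc0).
by have [Y Yfix] := (ex_fix q q01).2 qcq; exact: (xgetPex 0 (ex_intro _ Y Yfix)).
Qed.

Lemma Xfix_psd q : qc < q <= 1 -> psd (X q).
Proof. by move=> /Xfix_fixpoint[]. Qed.

Lemma crit_unit_itv q : qc < q <= 1 -> 0 <= q <= 1.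
Proof.
move=> /andP[qcq ->]; have [/andP[qc0 _] _] := crit.
by rewrite andbT (le_trans qc0) // ltW.
Qed.

Lemma Xfix_le_super q Z : qc < q <= 1 -> psd Z ->
  loewner (riccati A C Q V q Z) Z -> loewner (X q) Z.
Proof.
by move=> q1; apply: (fixpoint_le_super (crit_unit_itv q1)); exact: Xfix_fixpoint.
Qed.

Lemma Xfix_unique q Z : qc < q <= 1 -> riccati_fixpoint A C Q V q Z -> Z = X q.
Proof.
move=> q1 [Zpsd Zfix]; have [Xpsd XE] := Xfix_fixpoint q1.
apply: qform_inj => [||x]; [by case: Zpsd | by case: Xpsd |].
apply: le_anti; rewrite (Xfix_le_super q1) ?andbT //; last first.
  by rewrite -Zfix.
by apply: (fixpoint_le_super (crit_unit_itv q1)) => //; rewrite -XE.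
Qed.

Lemma Xfix_pd q : qc < q <= 1 -> pd (X q).
Proof.
move=> q1; have [Xpsd XE] := Xfix_fixpoint q1; split; first by case: Xpsd.
move=> x xN0; apply: lt_le_trans (Q_pd.2 x xN0) _.
by rewrite -!/(qform _ _) XE; apply: riccati_geQ => //; exact: crit_unit_itv.
Qed.

(** The map decreases with [q], so [X q] is a supersolution at [q']. *)
Lemma Xfix_anti q q' : qc < q -> q <= q' -> q' <= 1 -> loewner (X q') (X q).
Proof.
move=> qcq qq' q'1; have q1 : qc < q <= 1 by rewrite qcq (le_trans qq').
have q'1' : qc < q' <= 1 by rewrite q'1 (lt_le_trans qcq).
have [Xpsd XE] := Xfix_fixpoint q1; apply: Xfix_le_super => // x.
by rewrite {2}XE; exact: riccati_anti.
Qed.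

(** By [riccati_expand], [(1 + e) X(q')] is a supersolution at [q'] with slack
    [e Q]; the hypothesis says that lowering the parameter to [q] uses at most
    this slack.  All continuity of [X] comes from here. *)
Lemma Xfix_le_scale q q' e : qc < q -> q <= q' -> q' <= 1 -> 0 <= e ->
  loewner (((q' - q) * (1 + e)) *: (A *m X q' *m A^T)) (e *: Q) ->
  loewner (X q) ((1 + e) *: X q').
Proof.
move=> qcq qq' q'1 e0 slack; have q1 : qc < q <= 1 by rewrite qcq (le_trans qq').
have q'1' : qc < q' <= 1 by rewrite q'1 (lt_le_trans qcq).
have [Xpsd XE] := Xfix_fixpoint q'1'.
have e1 : 0 <= 1 + e by rewrite addr_ge0.
have Zpsd := psdZ e1 Xpsd; apply: Xfix_le_super => // x.
set Z := (1 + e) *: X q' in Zpsd *.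
have := slack x; rewrite !qformZ qform_congr => {slack}.
have q'0 : 0 <= q' by case/andP: (crit_unit_itv q'1').
have := riccati_expand x q'0 e0 Xpsd; rewrite -XE -/Z.
have := correction_le x Zpsd; rewrite !qform_riccati {2}/Z !qformZ.
by nra.
Qed.

End Riccati.

(** * The trace of the fixed point *)

(** What the optimization uses of [q |-> tr X(q)] on the interval [(qc, 1]]: it is
    a positive, antitone, continuous function, with no flat piece unless it is
    constant. *)
Record tradeoff {R : realType} (qc : R) (f : R -> R) : Prop := Tradeoff {
  tradeoff_unit : 0 <= qc < 1;
  tradeoff_gt0 : forall q, qc < q <= 1 -> 0 < f q;
  tradeoff_anti : forall q q', qc < q -> q <= q' -> q' <= 1 -> f q' <= f q;
  tradeoff_cont : forall q e, qc < q <= 1 -> 0 < e -> exists2 d, 0 < d &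
    forall q', qc < q' <= 1 -> `|q' - q| < d -> `|f q' - f q| < e;
  tradeoff_rigid : forall q q', qc < q -> q < q' -> q' <= 1 -> f q' = f q ->
    forall s, qc < s <= 1 -> f s = f 1 }.

Section Trace.
Context {R : realType} {n p : nat}.
Context (A : 'M[R]_n) (C : 'M[R]_(p, n)) (Q : 'M[R]_n) (V : 'M[R]_p).
Context (Q_pd : pd Q) (V_pd : pd V).
Context (qc : R) (crit : is_critical_value A C Q V qc).

Local Notation X := (Xfix A C Q V).
Local Notation f := (fun q => \tr (X q)).

Lemma trace_Xfix_gt0 q : (0 < n)%N -> qc < q <= 1 -> 0 < \tr (X q).
Proof.
move=> n0 q1; have Xpd := Xfix_pd Q_pd V_pd crit q1.
have diag i : 0 < X q i i.
  rewrite -qform_delta; apply: Xpd.2.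
  by apply/eqP => /matrixP/(_ i 0)/eqP; rewrite !mxE !eqxx oner_eq0.
rewrite /mxtrace (bigD1 (Ordinal n0)) //= ltr_pwDl // sumr_ge0 // => i _.
exact: ltW.
Qed.

Lemma trace_Xfix_anti q q' : qc < q -> q <= q' -> q' <= 1 ->
  \tr (X q') <= \tr (X q).
Proof. by move=> *; apply: mxtrace_le; exact: (Xfix_anti Q_pd V_pd crit). Qed.

(** Ordered matrices with equal traces are equal.  Subtracting the fixed point
    equations of [X q = X q'] shows that the correction vanishes there, so this
    matrix solves the equation for every parameter. *)
Lemma trace_Xfix_rigid q q' : qc < q -> q < q' -> q' <= 1 ->
  \tr (X q') = \tr (X q) -> forall s, qc < s <= 1 -> \tr (X s) = \tr (X 1).
Proof.
move=> qcq qq' q'1 trE.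
have q1 : qc < q <= 1 by rewrite qcq (le_trans (ltW qq')).
have q'1' : qc < q' <= 1 by rewrite q'1 (lt_trans qcq).
have [Xpsd XE] := Xfix_fixpoint crit q1.
have [X'psd X'E] := Xfix_fixpoint crit q'1'.
have XX : X q' = X q.
  apply: mxtrace_inj trE; [by case: X'psd | by case: Xpsd |].
  by apply: (Xfix_anti Q_pd V_pd crit) => //; exact: ltW.
have D0 x : qform (correction A C V (X q)) x = 0.
  have : qform (X q) x = qform (X q) x by [].
  rewrite {1}XE -{2}XX X'E XX !qform_riccati => /eqP.
  rewrite -subr_eq0 => /eqP h; apply/eqP.
  have : (q' - q) * qform (correction A C V (X q)) x = 0 by rewrite -h; ring.
  by move/eqP; rewrite mulf_eq0 subr_eq0 gt_eqF.
have fixed s : qc < s <= 1 -> X q = X s.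
  move=> s1; suff Xs : riccati_fixpoint A C Q V s (X q).
    exact: (Xfix_unique Q_pd V_pd crit s1 Xs).
  split; first exact: Xpsd.
  apply: qform_inj => [||x]; [by case: Xpsd | by apply: riccati_sym |].
  by rewrite {1}XE !qform_riccati D0 !mulr0.
move=> s s1; rewrite -!fixed // lexx andbT.
by apply: lt_le_trans q'1; exact: lt_trans qq'.
Qed.

(** Antitonicity bounds [A X(q') A^T] by [A X(q0) A^T] on [[q0, 1]], so the slack
    condition of [Xfix_le_scale] holds with an [e] of the order of [q' - q]. *)
Lemma trace_Xfix_lipschitz q0 : qc < q0 <= 1 -> exists d K, [/\ 0 < d, 0 <= K &
  forall q q', q0 <= q -> q <= q' -> q' <= 1 -> q' - q < d ->
    \tr (X q) - \tr (X q') <= K * (q' - q)].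
Proof.
move=> q01; have X0psd := Xfix_psd crit q01.
have [c c0 cX] := pd_dominates (A *m X q0 *m A^T) Q_pd.
have tr0 : 0 <= \tr (X q0).
  by apply: sumr_ge0 => i _; rewrite -qform_delta; exact: psd_ge0.
exists (c / 2), (2 / c * \tr (X q0)); split=> [||q q' q0q qq' q'1 close].
- by rewrite divr_gt0.
- by rewrite mulr_ge0 // divr_ge0 // ltW.
have qcq : qc < q by case/andP: q01 => h _; exact: lt_le_trans q0q.
set t := q' - q in close *; have t0 : 0 <= t by rewrite subr_ge0.
have ct : 0 < c - t by lra.
(* the solution of t (1 + e) = c e *)
pose e := t / (c - t); have e0 : 0 <= e by rewrite divr_ge0 // ltW.
have te : t * (1 + e) = c * e by rewrite /e; field; rewrite gt_eqF.
have qcq0 : qc < q0 by case/andP: q01.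
have slack : loewner ((t * (1 + e)) *: (A *m X q' *m A^T)) (e *: Q).
  move=> x; rewrite te !qformZ [c * e]mulrC -mulrA; apply: ler_wpM2l => //.
  apply: le_trans (cX x); rewrite qformZ; apply: ler_wpM2l; first exact: ltW.
  rewrite !qform_congr; apply: (Xfix_anti Q_pd V_pd crit) => //.
  exact: le_trans qq'.
have := mxtrace_le (Xfix_le_scale Q_pd V_pd crit qcq qq' q'1 e0 slack).
have : \tr (X q') <= \tr (X q0).
  by apply: trace_Xfix_anti => //; exact: le_trans qq'.
rewrite mxtraceZ => trX' trX.
have eE : e <= 2 / c * t.
  rewrite /e ler_pdivrMr // -subr_ge0.
  rewrite [leRHS](_ : _ = t * (c - 2 * t) / c); last by field; rewrite gt_eqF.
  by rewrite divr_ge0 ?(ltW c0) // mulr_ge0 //; lra.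
have : e * \tr (X q') <= e * \tr (X q0) by apply: ler_wpM2l.
have : e * \tr (X q0) <= 2 / c * t * \tr (X q0) by apply: ler_wpM2r.
by rewrite [2 / c * t * _]mulrAC; lra.
Qed.

Lemma trace_Xfix_cont q e : qc < q <= 1 -> 0 < e -> exists2 d, 0 < d &
  forall q', qc < q' <= 1 -> `|q' - q| < d -> `|\tr (X q') - \tr (X q)| < e.
Proof.
move=> /andP[qcq q1] e0; pose q0 := (qc + q) / 2.
have q01 : qc < q0 <= 1 by rewrite /q0; apply/andP; split; lra.
have [d [K [d0 K0 lip]]] := trace_Xfix_lipschitz q01.
pose r := Num.min (q - q0) (Num.min d (e / (K + 1))).
exists r.
  rewrite !lt_min d0 subr_gt0 /q0; apply/and3P; split=> //; first by lra.
  by rewrite divr_gt0 // ltr_wpDl.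
move=> q' /andP[qcq' q'1]; rewrite !lt_min => /and3P[near_q near_d near_e].
have Ke : K * `|q' - q| < e.
  rewrite ltr_pdivlMr ?ltr_wpDl // in near_e; apply: le_lt_trans near_e.
  by rewrite mulrC mulrDr mulr1 lerDl.
have q0q : q0 <= q by rewrite /q0; lra.
have q0q' : q0 <= q' by have := ler_norm (q - q'); rewrite distrC; lra.
have [qq'|/ltW qq'] := leP q q'.
  have lipq : \tr (X q) - \tr (X q') <= K * (q' - q).
    by apply: lip => //; apply: le_lt_trans near_d; exact: ler_norm.
  rewrite distrC ger0_norm; last by rewrite subr_ge0 trace_Xfix_anti.
  by apply: le_lt_trans lipq _; rewrite ger0_norm ?subr_ge0 in Ke.
have lipq : \tr (X q') - \tr (X q) <= K * (q - q').
  by apply: lip => //; apply: le_lt_trans near_d; rewrite distrC ler_norm.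
rewrite ger0_norm; last by rewrite subr_ge0 trace_Xfix_anti.
by apply: le_lt_trans lipq _; rewrite distrC ger0_norm ?subr_ge0 in Ke.
Qed.

Lemma trace_tradeoff : (0 < n)%N -> tradeoff qc f.
Proof.
move=> n0; split.
- by case: crit.
- by move=> q; exact: trace_Xfix_gt0.
- exact: trace_Xfix_anti.
- by move=> q e; exact: trace_Xfix_cont.
- exact: trace_Xfix_rigid.
Qed.

End Trace.

(** * Linear matrix inequalities *)

Section LMI.
Context {R : realType} {n p : nat}.
Context (A : 'M[R]_n) (C : 'M[R]_(p, n)) (Q : 'M[R]_n) (V : 'M[R]_p).
Context (Q_pd : pd Q) (V_pd : pd V).
Context (qc : R) (crit : is_critical_value A C Q V qc).

Local Notation X := (Xfix A C Q V).

Definition strict_super (q : R) (Z : 'M[R]_n) : Prop :=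
  pd Z /\ forall x, x != 0 -> qform (riccati A C Q V q Z) x < qform Z x.

(** The Schur complement of [Gamma q G H] is [G (Z - gain_update q K Z) G] for
    [Z = G^-1] and [H = G K]. *)
Lemma pd_Gamma q (G : 'M[R]_n) (K : 'M[R]_(n, p)) : 0 <= q <= 1 -> pd G ->
  pd (Gamma A C Q V q G (G *m K)) <->
  forall x, x != 0 ->
    qform (gain_update A C Q V q K (invmx G)) x < qform (invmx G) x.
Proof.
move=> /andP[q0 q1] Gpd; have Gu := pd_unitmx Gpd.
have [Vu Qu] := (pd_unitmx V_pd, pd_unitmx Q_pd).
have Zpd := pd_inv Gpd.
pose e := block_mx (invmx G) 0 0 (block_mx (invmx G) 0 0 (block_mx V 0 0 Q)).
rewrite /Gamma; set b := row_mx (_ *: (G *m A)) _.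
rewrite -!tr_row_mx -/b; set d := block_mx G 0 0 _.
have dpd : pd d by rewrite /d; do ?[apply: pd_block_diag => //]; exact: pd_inv.
have es : e^T = e.
  by rewrite /e !tr_block_mx !trmx0 Zpd.1 V_pd.1 Q_pd.1.
have de : d *m e = 1%:M.
  rewrite /d /e !mulmx_block !(mulmx0, mul0mx, addr0, add0r).
  by rewrite !mulmxV ?mulVmx // -!scalar_mx_block.
have bE y : qform e (b^T *m y) =
    qform (gain_update A C Q V q K (invmx G)) (G *m y).
  rewrite /b /e !tr_row_mx !mul_col_mx !qform_block_diag qform_gain_update.
  have -> : G *m A + G *m K *m C = G *m (A + K *m C) by rewrite mulmxDr mulmxA.
  rewrite ![(_ *: _)^T]linearZ /= -!scalemxAl !qformZr !sqr_sqrtr ?subr_ge0 //.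
  by rewrite !trmx_mul Gpd.1 -!mulmxA; ring.
have GE y : qform G y = qform (invmx G) (G *m y).
  by have := qform_congr G (invmx G) y; rewrite Gpd.1 mulmxV // mul1mx.
rewrite (pd_schur _ Gpd.1 dpd es de); split=> strict y yN0.
  have := strict (invmx G *m y); rewrite bE GE mulKVmx //; apply.
  by apply: contraNneq yN0 => /(congr1 (mulmx G)); rewrite mulKVmx // mulmx0 => ->.
rewrite bE GE; apply: strict.
by apply: contraNneq yN0 => /(congr1 (mulmx (invmx G))); rewrite mulKmx // mulmx0 => ->.
Qed.

(** The gain can be taken optimal, which turns [Gamma] into the strict Riccati
    inequality for [Z = G^-1]; the coupling says [Z <= Y], so [Y = Z] is the best
    choice for the trace. *)
Lemma lmi_feasibleP gamma q : 0 <= q <= 1 ->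
  lmi_feasible A C Q V gamma q <->
  exists2 Z, strict_super q Z & \tr Z <= gamma.
Proof.
move=> q01; have q0 : 0 <= q by case/andP: q01.
split=> [[G [H [Y [Gpd _ trY coup Gam]]]]|[Z [Zpd Zsup] trZ]].
  have Gu := pd_unitmx Gpd; have Zpd := pd_inv Gpd.
  exists (invmx G).
    split=> // x xN0.
    have gain_le := riccati_le_gain A C Q V_pd (invmx G *m H) (pd_psd Zpd) q0.
    apply: le_lt_trans (gain_le x) _.
    rewrite -[H](mulKVmx Gu) in Gam.
    exact: (pd_Gamma _ q01 Gpd).1 Gam x xN0.
  apply: le_trans trY; apply: mxtrace_le => x.
  have := coup.2 (col_mx x (- (invmx G *m x))); rewrite /coupling -{2}[1%:M]trmx1.
  rewrite -/(qform _ _) (qform_schur _ _ _ _ Gpd.1 Zpd.1 (mulmxV Gu)).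
  by rewrite trmx1 mul1mx addNr qform0r addr0 subr_ge0.
have Zu := pd_unitmx Zpd; have Gpd := pd_inv Zpd.
have Gu : invmx Z \in unitmx by rewrite unitmx_inv.
exists (invmx Z), (invmx Z *m opt_gain A C V Z), Z; split=> //.
- split; first by rewrite /coupling tr_block_mx Zpd.1 Gpd.1 !trmx1.
  move=> x; rewrite /coupling -{2}[1%:M]trmx1 -/(qform _ _) -[x]vsubmxK.
  rewrite (qform_schur _ _ _ _ Gpd.1 Zpd.1 (mulVmx Zu)) trmx1 mul1mx subrr add0r.
  exact: pd_ge0.
- apply/(pd_Gamma _ q01 Gpd); rewrite invmxK => x xN0.
  by rewrite gain_update_opt //; [exact: Zsup | exact: pd_psd].
Qed.

(** A feasible point provides a supersolution, and this dominates [X q]. *)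
Lemma lmi_trace gamma q : qc < q <= 1 -> lmi_feasible A C Q V gamma q ->
  \tr (X q) <= gamma.
Proof.
move=> q1 /(lmi_feasibleP _ (crit_unit_itv crit q1))[Z [Zpd Zsup]].
apply: le_trans; apply: mxtrace_le.
apply: (Xfix_le_super Q_pd V_pd crit q1) => [|x]; first exact: pd_psd.
have [->|xN0] := eqVneq x 0; first by rewrite !qform0r.
by apply: ltW; exact: Zsup.
Qed.

(** Any room left by the trace bound is used to enlarge [X q] by a factor,
    which makes it a strict supersolution. *)
Lemma trace_lmi gamma gamma' q : (0 < n)%N -> qc < q <= 1 -> gamma < gamma' ->
  \tr (X q) <= gamma -> lmi_feasible A C Q V gamma' q.
Proof.
move=> n0 q1 lt_gamma trX; apply/(lmi_feasibleP _ (crit_unit_itv crit q1)).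
have [Xpsd XE] := Xfix_fixpoint crit q1; have Xpd := Xfix_pd Q_pd V_pd crit q1.
have tr0 := trace_Xfix_gt0 Q_pd V_pd crit n0 q1.
pose e := gamma' / \tr (X q) - 1.
have e0 : 0 < e by rewrite subr_gt0 ltr_pdivlMr // mul1r; lra.
exists ((1 + e) *: X q); last by rewrite mxtraceZ /e addrC subrK divfK ?gt_eqF.
have e1 : 0 < 1 + e by lra.
split.
  split; first by rewrite linearZ /= Xpd.1.
  by move=> x xN0; rewrite -/(qform _ _) qformZ mulr_gt0 //; exact: Xpd.2.
move=> x xN0; have q0 : 0 <= q by case/andP: (crit_unit_itv crit q1).
have := riccati_expand A C Q V_pd x q0 (ltW e0) Xpsd; rewrite -XE qformZ.
by apply: lt_le_trans; rewrite ltrDl mulr_gt0 //; exact: Q_pd.2.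
Qed.

(** A strict supersolution at [q] is one at [q'], the optimal gain being
    recomputed.  This is what makes bisection on [q] legitimate. *)
Lemma lmi_upward gamma q q' : 0 <= q -> q <= q' -> q' <= 1 ->
  lmi_feasible A C Q V gamma q -> lmi_feasible A C Q V gamma q'.
Proof.
move=> q0 qq' q'1.
have q1 : 0 <= q <= 1 by rewrite q0 (le_trans qq').
have q'01 : 0 <= q' <= 1 by rewrite q'1 (le_trans q0).
move=> /(lmi_feasibleP _ q1)[Z [Zpd Zsup] trZ].
apply/(lmi_feasibleP _ q'01); exists Z => //; split=> // x /Zsup.
by apply: le_lt_trans; apply: riccati_anti => //; exact: pd_psd.
Qed.

End LMI.

(** * Minimal parameter for a trace level *)

Section MinOr1.
Context {R : realType}.

Lemma min_or1_le (S : set R) c x : lbound S c -> S x -> min_or1 S <= x.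
Proof.
move=> Sc Sx; rewrite /min_or1 asboolT; last by exists x.
by apply: ge_inf => //; exists c.
Qed.

Lemma min_or1_ge (S : set R) c : lbound S c -> c <= 1 -> c <= min_or1 S.
Proof.
move=> Sc c1; rewrite /min_or1; case: asboolP => // ne.
exact: lb_le_inf.
Qed.

Lemma min_or1_empty (S : set R) : ~ (S !=set0) -> min_or1 S = 1.
Proof. by move=> e; rewrite /min_or1 asboolF. Qed.

End MinOr1.

Section LevelMin.
Context {R : realType} (qc : R) (f : R -> R) (ft : tradeoff qc f).

Definition sublevel (gamma : R) : set R := [set q | f q <= gamma /\ qc < q <= 1].

Definition nonconstant : Prop := exists2 s, qc < s <= 1 & f s != f 1.

Definition level_min (gamma : R) : R := min_or1 (sublevel gamma).

Lemma sublevel_lbound gamma : lbound (sublevel gamma) qc.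
Proof. by move=> q [_ /andP[/ltW]]. Qed.

Lemma level_min_le gamma q : sublevel gamma q -> level_min gamma <= q.
Proof. exact: min_or1_le (@sublevel_lbound gamma). Qed.

Lemma level_min_itv gamma : qc <= level_min gamma <= 1.
Proof.
have [/andP[_ /ltW qc1] _ _ _ _] := ft.
apply/andP; split; first exact: min_or1_ge (@sublevel_lbound gamma) qc1.
have [[q sq]|e] := pselect (sublevel gamma !=set0); last first.
  by rewrite /level_min min_or1_empty.
by apply: le_trans (level_min_le sq) _; case: sq => _ /andP[].
Qed.

Lemma sublevel_up gamma q q' : q <= q' -> q' <= 1 ->
  sublevel gamma q -> sublevel gamma q'.
Proof.
move=> qq' q'1 [fq /andP[qcq q1]]; split.
  by apply: le_trans fq; exact: (tradeoff_anti ft).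
by rewrite q'1 andbT (lt_le_trans qcq).
Qed.

Lemma level_min_lt gamma q : level_min gamma < q -> q <= 1 -> sublevel gamma q.
Proof.
have [ne|e] := pselect (sublevel gamma !=set0); last first.
  by rewrite /level_min min_or1_empty // ltNge => /negP.
rewrite /level_min /min_or1 asboolT // => lt_q q1.
by have [q' sq' /ltW q'q] := inf_lt ne lt_q; exact: sublevel_up sq'.
Qed.

(** Right continuity at the infimum.  Without the second hypothesis the infimum
    is the excluded end point [qc]. *)
Lemma level_min_attained gamma : sublevel gamma !=set0 ->
  qc < level_min gamma -> sublevel gamma (level_min gamma).
Proof.
move=> [q0 sq0] qcm; have q01 : q0 <= 1 by case: sq0 => _ /andP[].
set m := level_min gamma in qcm *.
have /andP[_ m1] := level_min_itv gamma; rewrite -/m in m1.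
have [/eqP m1E|mN1] := boolP (m == 1).
  by apply: sublevel_up sq0; rewrite ?m1E.
have mlt1 : m < 1 by rewrite lt_neqAle mN1.
have m1' : qc < m <= 1 by rewrite qcm.
split=> //; rewrite leNgt; apply/negP => gamma_lt.
have e0 : 0 < f m - gamma by rewrite subr_gt0.
have [d d0 near] := tradeoff_cont ft m1' e0.
pose q := Num.min 1 (m + d / 2).
have mq : m < q by rewrite lt_min mlt1 ltrDl divr_gt0.
have q1 : q <= 1 by rewrite ge_min lexx.
have qd : q <= m + d / 2 by rewrite ge_min lexx orbT.
have [fq q1'] := level_min_lt mq q1.
have := near q q1'; rewrite ger0_norm ?subr_ge0 ?(ltW mq) // => /(_ _).
have -> : q - m < d by lra.
by move=> /(_ isT); have := ler_norm (f m - f q); rewrite distrC; lra.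
Qed.

(** Left continuity at [q], which is interior on the left since [qc] is excluded. *)
Lemma level_min_strict gamma q : qc < q <= 1 -> f q < gamma ->
  level_min gamma < q.
Proof.
move=> q1 fq; have e0 : 0 < gamma - f q by rewrite subr_gt0.
have [d d0 near] := tradeoff_cont ft q1 e0.
have /andP[qcq q1'] := q1.
pose q' := Num.max ((qc + q) / 2) (q - d / 2).
have q'q : q' < q by rewrite gt_max; apply/andP; split; lra.
have qcq' : qc < q' by rewrite lt_max; apply/orP; left; lra.
have q'd : q - d / 2 <= q' by rewrite le_max lexx orbT.
have q'1 : q' <= 1 by apply: le_trans q1'; exact: ltW.
apply: le_lt_trans (q'q); apply: level_min_le.
split; last by rewrite qcq'.
have := near q'; rewrite qcq' q'1 distrC ger0_norm ?subr_ge0 ?(ltW q'q) //.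
move=> /(_ isT); have -> : q - q' < d by lra.
by move=> /(_ isT); have := ler_norm (f q' - f q); lra.
Qed.

Lemma sublevel_mono gamma gamma' : gamma <= gamma' ->
  sublevel gamma `<=` sublevel gamma'.
Proof. by move=> gg' q [fq q1]; split=> //; exact: le_trans gg'. Qed.

Lemma level_min_anti gamma gamma' : gamma <= gamma' ->
  level_min gamma' <= level_min gamma.
Proof.
move=> gg'; rewrite leNgt; apply/negP => lt.
have /andP[_ m1] := level_min_itv gamma'.
pose q := (level_min gamma + level_min gamma') / 2.
have /(sublevel_mono gg')/level_min_le : sublevel gamma q.
  by apply: level_min_lt; rewrite /q; lra.
by rewrite /q; lra.
Qed.

Lemma level_min_strict_anti gamma gamma' : gamma < gamma' ->
  sublevel gamma !=set0 -> qc < level_min gamma ->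
  level_min gamma' < level_min gamma.
Proof.
move=> gg' ne qcm; have [fm m1] := level_min_attained ne qcm.
by apply: level_min_strict => //; exact: le_lt_trans gg'.
Qed.

Lemma tradeoff_strict q q' : nonconstant ->
  qc < q -> q < q' -> q' <= 1 -> f q' < f q.
Proof.
move=> [s s1 fs] qcq qq' q'1.
rewrite lt_neqAle (tradeoff_anti ft) ?andbT ?(ltW qq') //.
by apply: contraNneq fs => e; rewrite (tradeoff_rigid ft qcq qq').
Qed.

(** The generalized inverse of an antitone function jumps only where that
    function is flat. *)
Lemma level_min_cont : nonconstant ->
  continuous level_min.
Proof.
move=> nonconst gamma; apply/(@cvgrPdist_lt _ _ _ (nbhs gamma)) => e e0.
set m := level_min gamma.
have /andP[qcm m1] : qc <= m <= 1 := level_min_itv gamma.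
(* f strictly decreases just to the right of m *)
have from_left : exists2 d, 0 < d &
    forall g, gamma - d < g -> level_min g < m + e.
  have [e1|e1] := ltP 1 (m + e).
    by exists 1 => // g _; case/andP: (level_min_itv g) => _ /le_lt_trans; apply.
  have [fq1 /andP[qcq1 _]] : sublevel gamma (m + e / 3).
    by apply: level_min_lt; rewrite -/m; lra.
  have flt : f (m + e / 2) < f (m + e / 3).
    by apply: tradeoff_strict => //; lra.
  exists (gamma - f (m + e / 2)); first by lra.
  move=> g lt_g; apply: (@le_lt_trans _ _ (m + e / 2)); last by lra.
  by apply: level_min_le; split; [lra | apply/andP; split; lra].
(* f exceeds gamma just to the left of m *)
have from_right : exists2 d, 0 < d &
    forall g, g < gamma + d -> m - e < level_min g.
  have [e1|e1] := ltP (m - e) qc.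
    by exists 1 => // g _; case/andP: (level_min_itv g) => /(lt_le_trans e1).
  pose q := m - e / 2.
  have fq : gamma < f q.
    rewrite ltNge; apply/negP => fq.
    have : m <= q
      by apply: level_min_le; split => //; apply/andP; rewrite /q; split; lra.
    by rewrite /q; lra.
  exists (f q - gamma); first by lra.
  move=> g lt_g; rewrite ltNge; apply/negP => le_g.
  have [+ _] : sublevel g q by apply: level_min_lt; rewrite /q; lra.
  by lra.
have [d d0 left] := from_left; have [d' d'0 right] := from_right.
near=> g; rewrite ltr_distlC; apply/andP; split.
  apply: right; near: g; apply: (@lt_nbhsl R); lra.
apply: left; near: g; apply: (@lt_nbhsr R); lra.
Unshelve. all: by end_near.
Qed.

End LevelMin.

(** * Bisection *)

Section Bisection.
Context {R : realType} (P : R -> bool).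

Lemma bisection_width l u k :
  (bisection P l u k).2 - (bisection P l u k).1 = (u - l) / 2 ^+ k.
Proof.
elim: k => [|k IH]; first by rewrite expr0 divr1.
rewrite /bisection iterS -/(bisection P l u k) /bisection_step.
set b := bisection P l u k in IH *.
have -> : (u - l) / 2 ^+ k.+1 = (b.2 - b.1) / 2.
  by rewrite IH exprSr invfM mulrA.
by case: ifP => _ /=; field.
Qed.

(** Invariants for the two ends; midpoints are interior, so [P] need only be
    informative strictly between the initial ends. *)
Lemma bisection_ind (Pl Pu : R -> Prop) l u : l < u -> Pl l -> Pu u ->
  (forall m, l < m < u -> P m -> Pu m) ->
  (forall m, l < m < u -> ~~ P m -> Pl m) ->
  forall k, let b := bisection P l u k in
    [/\ Pl b.1, Pu b.2 & [/\ l <= b.1, b.1 < b.2 & b.2 <= u]].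
Proof.
move=> lu Pl_l Pu_u stepu stepl; elim=> [|k IH]; first by split.
rewrite /bisection iterS -/(bisection P l u k) /bisection_step.
move: (bisection P l u k) IH => [a b] /= [Pa Pb [la ab bu]].
have m_in : l < (a + b) / 2 < u by apply/andP; split; lra.
case: ifP => [/(stepu _ m_in)|/negbT/(stepl _ m_in)] Pm /=; split=> //; split; lra.
Qed.

End Bisection.

(** * Allocation of the budget *)

Section Allocation.
Context {R : realType} {N : nat} (qc : 'I_N -> R) (f : 'I_N -> R -> R).
Context (ft : forall i, tradeoff (qc i) (f i)).
Context (N_gt0 : (0 < N)%N) (sum_qc : \sum_i qc i < 1).

Local Notation D := (OP_feasible qc).
Local Notation lmin i := (level_min (qc i) (f i)).

Definition objective (q : 'rV[R]_N) : R := \big[Num.max/0]_i f i (q 0 i).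

Definition objective_level : set ('rV[R]_N * R) :=
  [set z : 'rV[R]_N * R |
           [/\ 0 < z.2, forall i, f i (z.1 0 i) <= z.2,
               \sum_i z.1 0 i = 1 & forall i, qc i < z.1 0 i <= 1]].

Definition total_min (gamma : R) : R := \sum_i lmin i gamma.

Local Notation m := total_min.
Local Notation opt := (inf (objective @` D)).

Let i0 : 'I_N := Ordinal N_gt0.

Lemma qc_ge0 i : 0 <= qc i.
Proof. by have [/andP[]] := ft i. Qed.

Lemma sumr_lt (g h : 'I_N -> R) : (forall i, g i < h i) -> \sum_i g i < \sum_i h i.
Proof. by move=> gh; apply: ltr_sum => //; apply/hasP; exists i0. Qed.

Lemma objective_leP q c : D q ->
  (objective q <= c) <-> (forall i, f i (q 0 i) <= c).
Proof.
move=> [_ qin]; split=> [/bigmax_leP[_ h] i|h]; first exact: h.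
apply/bigmax_leP; split=> //; apply: le_trans (h i0); apply: ltW.
exact: (tradeoff_gt0 (ft i0)).
Qed.

Lemma f_le_objective q i : D q -> f i (q 0 i) <= objective q.
Proof. by move=> Dq; move: i; apply/objective_leP. Qed.

Lemma objective_gt0 q : D q -> 0 < objective q.
Proof.
move=> Dq; apply: lt_le_trans (f_le_objective i0 Dq).
by apply: (tradeoff_gt0 (ft i0)); case: Dq.
Qed.

(** Every coordinate receives the same share of what is left of the budget. *)
Lemma spread (g : 'I_N -> R) : (forall i, qc i <= g i) -> \sum_i g i < 1 ->
  exists2 q, D q & forall i, g i < q 0 i.
Proof.
move=> qcg g1; pose t := (1 - \sum_i g i) / N%:R.
have N0 : 0 < N%:R :> R by rewrite ltr0n.
have t0 : 0 < t by rewrite divr_gt0 // subr_gt0.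
have tE : t * N%:R = 1 - \sum_i g i by rewrite divfK // gt_eqF.
exists (\row_i (g i + t)) => [|i]; last by rewrite mxE ltrDl.
have sumE : \sum_i (\row_i (g i + t)) 0 i = 1 :> R.
  under eq_bigr do rewrite mxE.
  by rewrite big_split /= sumr_const card_ord -[t *+ N]mulr_natr tE addrC subrK.
split=> // i; rewrite mxE (le_lt_trans (qcg i)) ?ltrDl //=.
have := sumE; under eq_bigr do rewrite mxE; rewrite (bigD1 i) //= => <-.
rewrite lerDl sumr_ge0 // => j _; rewrite addr_ge0 ?(ltW t0) //.
exact: le_trans (qc_ge0 j) (qcg j).
Qed.

Lemma OP_feasible_nonempty : D !=set0.
Proof. by have [q Dq _] := spread (fun i => lexx (qc i)) sum_qc; exists q. Qed.

Lemma conv_ge_min (t a b : R) : 0 <= t <= 1 ->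
  Num.min a b <= t * a + (1 - t) * b.
Proof. by move=> /andP[t0 t1]; have [ab|ab] := leP a b; nra. Qed.

Lemma OP_feasible_convex q q' (t : R) : 0 <= t <= 1 -> D q -> D q' ->
  D (t *: q + (1 - t) *: q').
Proof.
move=> t01 [qs qin] [q's q'in]; split=> [|i].
  under eq_bigr do rewrite !mxE.
  by rewrite big_split -!mulr_sumr qs q's /=; lra.
rewrite !mxE; have /andP[a1 a2] := qin i; have /andP[b1 b2] := q'in i.
rewrite (lt_le_trans _ (conv_ge_min _ _ t01)) ?lt_min ?a1 //=.
by move: t01 => /andP[t0 t1]; nra.
Qed.

(** Antitone functions of one variable are quasi-convex: a convex combination
    lies above the smaller end point. *)
Lemma objective_level_convex c q q' (t : R) : 0 <= t <= 1 -> D q -> D q' ->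
  objective q <= c -> objective q' <= c ->
  objective (t *: q + (1 - t) *: q') <= c.
Proof.
move=> t01 Dq Dq'; have Dz := OP_feasible_convex t01 Dq Dq'.
move=> /(objective_leP _ Dq) qc' /(objective_leP _ Dq') q'c.
apply/(objective_leP _ Dz) => i; have [_ /(_ i)/andP[_ z1]] := Dz.
have [_ /(_ i)/andP[a1 a2]] := Dq; have [_ /(_ i)/andP[b1 b2]] := Dq'.
set z := (t *: q + (1 - t) *: q') 0 i in z1 *.
have : Num.min (q 0 i) (q' 0 i) <= z by rewrite /z !mxE conv_ge_min.
rewrite ge_min => /orP[le_z|le_z].
  by apply: le_trans (qc' i); exact: (tradeoff_anti (ft i)).
by apply: le_trans (q'c i); exact: (tradeoff_anti (ft i)).
Qed.

Lemma quasiconvex_objective : quasiconvex_problem D objective.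
Proof.
split=> [q q' t|c q q' t]; rewrite !inE.
  move=> Dq Dq'; apply: OP_feasible_convex => //.
  by rewrite ge0 le1.
move=> [Dq qle] [Dq' q'le]; have t01 : 0 <= t%:num <= 1 by rewrite ge0 le1.
split; first exact: OP_feasible_convex.
exact: objective_level_convex.
Qed.

Lemma objective_levelP q gamma :
  objective_level (q, gamma) <-> D q /\ objective q <= gamma.
Proof.
split=> [[_ fle qs qin]|[Dq ole]] /=.
  have Dq : D q by split.
  by split=> //; apply/(objective_leP _ Dq).
have [qs qin] := Dq; split=> //=; first exact: lt_le_trans (objective_gt0 Dq) ole.
exact/(objective_leP _ Dq).
Qed.

Lemma level_minimizerP q gamma : is_minimizer objective_level snd (q, gamma) <->
  is_minimizer D objective q /\ gamma = objective q.
Proof.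
split=> [[/objective_levelP[Dq ole] min]|[[Dq min] ->]].
  have gE : gamma = objective q.
    apply/le_anti; rewrite ole andbT; apply: (min (q, objective q)).
    exact/objective_levelP.
  split=> //; split=> // q' Dq'; rewrite -gE.
  by apply: (min (q', objective q')); apply/objective_levelP.
split; first exact/objective_levelP.
by move=> [q' g] /objective_levelP[Dq' ole] /=; exact: le_trans (min _ Dq') ole.
Qed.

Lemma opt_le q : D q -> opt <= objective q.
Proof.
move=> Dq; apply: ge_inf; last by exists q.
by exists 0 => _ [q' Dq' <-]; exact: ltW (objective_gt0 Dq').
Qed.

Lemma opt_ge c : (forall q, D q -> c <= objective q) -> c <= opt.
Proof.
move=> h; apply: lb_le_inf => [|_ [q Dq <-]]; last exact: h.
by have [q Dq] := OP_feasible_nonempty; exists (objective q), q.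
Qed.

Lemma opt_lt gamma : opt < gamma -> exists2 q, D q & objective q < gamma.
Proof.
move=> lt_g; have [|_ [q Dq <-] ltq] := inf_lt _ lt_g; last by exists q.
by have [q Dq] := OP_feasible_nonempty; exists (objective q), q.
Qed.

Lemma inf_objective_level : inf (snd @` objective_level) = opt.
Proof.
apply/le_anti/andP; split.
  apply: opt_ge => q Dq; apply: ge_inf.
    by exists 0 => _ [[q' g] [g0 _ _ _] <-]; exact: ltW.
  by exists (q, objective q) => //; apply/objective_levelP.
apply: lb_le_inf => [|_ [[q g] /objective_levelP[Dq ole] <-]].
  have [q Dq] := OP_feasible_nonempty; exists (objective q).
  by exists (q, objective q) => //; apply/objective_levelP.
exact: le_trans (opt_le Dq) ole.
Qed.

Lemma objective_level_section_convex gamma :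
  convex_set [set q | objective_level (q, gamma)].
Proof.
move=> q q' t; rewrite !inE.
move=> /objective_levelP[Dq ql] /objective_levelP[Dq' q'l].
have t01 : 0 <= t%:num <= 1 by rewrite ge0 le1.
apply/objective_levelP; split; first exact: OP_feasible_convex.
exact: objective_level_convex.
Qed.

Lemma total_min_anti gamma gamma' : gamma <= gamma' -> m gamma' <= m gamma.
Proof. by move=> gg'; apply: ler_sum => i _; exact: (level_min_anti (ft i)). Qed.

(** The minimal shares leave some budget, so [spread] gives shares strictly
    above them, and these are feasible for the level. *)
Lemma total_min_lt1 gamma : m gamma < 1 ->
  exists q, [/\ D q, objective q <= gamma & forall i, lmin i gamma < q 0 i].
Proof.
move=> m1; have [|q Dq lq] := spread _ m1.
  by move=> i; case/andP: (level_min_itv (ft i) gamma).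
exists q; split=> //; apply/(objective_leP _ Dq) => i.
have [_ /(_ i)/andP[_ q1]] := Dq.
by have [] := level_min_lt (ft i) (lq i) q1.
Qed.

(** By continuity a share whose trace is strictly below [gamma] can be lowered,
    so it exceeds the minimal share. *)
Lemma objective_lt_min q gamma : D q -> objective q < gamma ->
  forall i, lmin i gamma < q 0 i.
Proof.
move=> Dq og i; apply: (level_min_strict (ft i)); first by case: Dq.
exact: le_lt_trans (f_le_objective i Dq) og.
Qed.

Lemma objective_lt_total q gamma : D q -> objective q < gamma -> m gamma < 1.
Proof. by move=> Dq og; have [<- _] := Dq; exact/sumr_lt/objective_lt_min. Qed.

Lemma opt_le_of_total gamma : m gamma < 1 -> opt <= gamma.
Proof.
by move=> /total_min_lt1[q [Dq oq _]]; exact: le_trans (opt_le Dq) oq.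
Qed.

Lemma opt_ge_of_total gamma : 1 <= m gamma -> gamma <= opt.
Proof.
move=> m1; apply: opt_ge => q Dq; rewrite leNgt; apply/negP.
by move=> /(objective_lt_total Dq); rewrite ltNge m1.
Qed.

Lemma total_min0 : 1 <= m 0.
Proof.
have empty i : lmin i 0 = 1.
  apply: min_or1_empty => -[q [fq /(tradeoff_gt0 (ft i))]].
  by rewrite ltNge fq.
rewrite /total_min; under eq_bigr do rewrite empty.
by rewrite sumr_const card_ord ler1n.
Qed.

Lemma total_min_small : exists2 u, 0 < u & m u < 1.
Proof.
have [q Dq] := OP_feasible_nonempty; have o0 := objective_gt0 Dq.
exists (objective q + 1); first exact: addr_gt0.
by apply: (objective_lt_total Dq); rewrite ltrDl.
Qed.

Lemma total_bisection l0 u0 : 1 <= m l0 -> m u0 < 1 -> forall k,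
  let b := bisection (fun gamma => m gamma < 1) l0 u0 k in
  1 <= m b.1 /\ m b.2 < 1.
Proof.
move=> ml mu k /=; have lu : l0 < u0.
  by rewrite ltNge; apply/negP => /total_min_anti; rewrite leNgt (lt_le_trans mu).
have [] // := bisection_ind (P := fun gamma => m gamma < 1)
  (Pl := fun g => 1 <= m g) (Pu := fun g => m g < 1) lu ml mu _ _ k.
by move=> g _; rewrite -leNgt.
Qed.

Lemma bisection_brackets_opt l0 u0 k : 1 <= m l0 -> m u0 < 1 ->
  let b := bisection (fun gamma => m gamma < 1) l0 u0 k in b.1 <= opt <= b.2.
Proof.
move=> ml mu /=; have [ml' mu'] := total_bisection ml mu k.
by rewrite opt_ge_of_total // opt_le_of_total.
Qed.

Lemma total_min_cont : (forall i, nonconstant (qc i) (f i)) -> continuous m.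
Proof.
move=> nc gamma; apply: cvg_big => [|i _]; first exact: add_continuous.
exact: (level_min_cont (ft i) (nc i)).
Qed.

Lemma half_pow_cvg0 (w : R) : (fun k => w / 2 ^+ k) @ \oo --> (0 : R).
Proof.
have : `|2^-1 : R| < 1 by rewrite ger0_norm ?invr_ge0 // invf_lt1 ?ltr1n.
move=> /(cvg_geometric w); rewrite /geometric /=.
by under eq_fun do rewrite exprVn.
Qed.

Lemma bisection_cvg_opt l0 u0 : 1 <= m l0 -> m u0 < 1 ->
  (fun k => (bisection (fun gamma => m gamma < 1) l0 u0 k).1) @ \oo --> opt /\
  (fun k => (bisection (fun gamma => m gamma < 1) l0 u0 k).2) @ \oo --> opt.
Proof.
move=> ml mu; pose w := u0 - l0; set b := bisection _ _ _.
have width k : (b k).2 - (b k).1 = w / 2 ^+ k by exact: bisection_width.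
have br k : (b k).1 <= opt <= (b k).2 by exact: bisection_brackets_opt.
split; apply/cvgrPdist_lt => e e0;
  have /cvgrPdist_lt/(_ e e0) := half_pow_cvg0 w;
  apply: filterS => k; rewrite sub0r normrN => h;
  apply: le_lt_trans h; rewrite -width; have /andP[bl bu] := br k.
- rewrite !ger0_norm ?subr_ge0 ?lerD2r //; exact: le_trans bu.
- rewrite distrC !ger0_norm ?subr_ge0 ?lerD2l ?lerN2 //; exact: le_trans bu.
Qed.

Lemma total_min_opt : (forall i, nonconstant (qc i) (f i)) -> m opt = 1.
Proof.
move=> /total_min_cont/(_ opt) mc; have [u _ mu] := total_min_small.
have [cl cu] := bisection_cvg_opt total_min0 mu.
have tb := total_bisection total_min0 mu.
apply/le_anti/andP; split.
  have cm := cvg_comp _ _ cu mc; rewrite -(cvg_lim _ cm) //.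
  apply: limr_le; first by apply/cvg_ex; exists (m opt).
  by near=> k; case: (tb k) => _ /ltW.
have cm := cvg_comp _ _ cl mc; rewrite -(cvg_lim _ cm) //.
apply: limr_ge; first by apply/cvg_ex; exists (m opt).
by near=> k; case: (tb k).
Unshelve. all: by end_near.
Qed.

Lemma total_bisection_cvg l0 u0 : (forall i, nonconstant (qc i) (f i)) ->
  1 <= m l0 -> m u0 < 1 ->
  (fun k => m (bisection (fun gamma => m gamma < 1) l0 u0 k).1) @ \oo --> (1 : R) /\
  (fun k => m (bisection (fun gamma => m gamma < 1) l0 u0 k).2) @ \oo --> (1 : R).
Proof.
move=> nc ml mu; have [cl cu] := bisection_cvg_opt ml mu.
have mc : m x @[x --> opt] --> (1 : R).
  by have /(_ opt) := total_min_cont nc; rewrite /continuous_at (total_min_opt nc).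
by split; [exact: cvg_comp cl mc | exact: cvg_comp cu mc].
Qed.

Let feasible gamma := forall i, sublevel (qc i) (f i) gamma !=set0.

Lemma feasible_mono gamma gamma' : gamma <= gamma' ->
  feasible gamma -> feasible gamma'.
Proof.
move=> gg' h i; have [q qi] := h i; exists q; exact: sublevel_mono gg' _ qi.
Qed.

(** The minimal shares sum to more than the [qc i], so one of them exceeds its
    [qc j], and that one decreases strictly. *)
Lemma total_min_strict gamma gamma' : gamma < gamma' -> feasible gamma ->
  1 <= m gamma -> m gamma' < m gamma.
Proof.
move=> gg' feas m1.
have [j qcj] : exists j, qc j < lmin j gamma.
  apply: contrapT => none; have : m gamma <= \sum_i qc i.
    by apply: ler_sum => i _; rewrite leNgt; apply/negP => h; apply: none; exists i.
  by rewrite leNgt (lt_le_trans sum_qc).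
rewrite /total_min (bigD1 j) //= [ltRHS](bigD1 j) //=; apply: ltr_leD.
  exact: (level_min_strict_anti (ft j)).
by apply: ler_sum => i _; apply: (level_min_anti (ft i)); exact: ltW.
Qed.

(** Above [opt + eps] the sum stays below [m (opt + eps) < 1].  Below
    [opt - eps], feasible levels exist only if [opt - eps] is feasible, and then
    the sum stays above [m (opt - eps)], which exceeds [1] because [m] decreases
    strictly from there to [opt - eps / 2], where it is still at least [1]. *)
Lemma total_min_near_opt eps : 0 < eps -> exists2 delta, 0 < delta &
  forall gamma, feasible gamma -> `|m gamma - 1| <= delta ->
    `|gamma - opt| <= eps.
Proof.
move=> eps0.
have [q Dq oq] : exists2 q, D q & objective q < opt + eps.
  by apply: opt_lt; rewrite ltrDl.
have m_hi := objective_lt_total Dq oq.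
pose d1 := 1 - m (opt + eps).
have d10 : 0 < d1 by rewrite subr_gt0.
have [d2 d20 lo] : exists2 d2, 0 < d2 &
    forall gamma, feasible gamma -> gamma < opt - eps -> 1 + d2 <= m gamma.
  have [feas|infeas] := pselect (feasible (opt - eps)); last first.
    exists 1 => // gamma fg /ltW lt_g; case: infeas; exact: feasible_mono fg.
  have m1 : 1 < m (opt - eps).
    have m1 : 1 <= m (opt - eps).
      by rewrite leNgt; apply/negP => /opt_le_of_total; rewrite leNgt gtrBl eps0.
    have lt_half : opt - eps < opt - eps / 2 by lra.
    apply: le_lt_trans (total_min_strict lt_half feas m1).
    by rewrite leNgt; apply/negP => /opt_le_of_total; lra.
  exists (m (opt - eps) - 1); first by rewrite subr_gt0.
  by move=> gamma _ /ltW/total_min_anti; lra.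
exists (Num.min d1 d2 / 2); first by rewrite divr_gt0 // lt_min d10.
have min1 : Num.min d1 d2 <= d1 by rewrite ge_min lexx.
have min2 : Num.min d1 d2 <= d2 by rewrite ge_min lexx orbT.
move=> gamma feas; rewrite ler_norml => /andP[lo_m hi_m].
rewrite ler_norml; apply/andP; split; rewrite leNgt; apply/negP => far.
  have far' : gamma < opt - eps by lra.
  by have := lo gamma feas far'; lra.
have far' : opt + eps <= gamma by lra.
by have := total_min_anti far'; rewrite /d1 in min1 d10 *; lra.
Qed.

Lemma total_min_minimizer gamma : feasible gamma -> m gamma = 1 ->
  (forall i, qc i < lmin i gamma) ->
  is_minimizer D objective (\row_i lmin i gamma).
Proof.
move=> feas m1 inner; set q := \row_i _.
have qE i : q 0 i = lmin i gamma by rewrite mxE.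
have Dq : D q.
  split; first by under eq_bigr do rewrite qE.
  by move=> i; rewrite qE inner; case/andP: (level_min_itv (ft i) gamma).
have oq : objective q <= gamma.
  apply/(objective_leP _ Dq) => i; rewrite qE.
  by case: (level_min_attained (ft i) (feas i) (inner i)).
split=> // q' Dq'; rewrite leNgt; apply/negP => lt_o.
by have := objective_lt_total Dq' (lt_le_trans lt_o oq); rewrite m1 ltxx.
Qed.

End Allocation.

(** * The subproblems *)

Section Subproblem.
Context {R : realType} {n p : nat}.
Context (A : 'M[R]_n) (C : 'M[R]_(p, n)) (Q : 'M[R]_n) (V : 'M[R]_p).
Context (n_gt0 : (0 < n)%N) (Q_pd : pd Q) (V_pd : pd V).
Context (qc : R) (crit : is_critical_value A C Q V qc).

Local Notation f := (fun q => \tr (Xfix A C Q V q)).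
Local Notation lmi := (lmi_feasible A C Q V).
Local Notation ql := (qlmi A C Q V qc).
Local Notation qo := (qopt A C Q V qc).

Let ft : tradeoff qc f := trace_tradeoff Q_pd V_pd crit n_gt0.

Lemma lmi_set_lbound gamma c : (forall q, qc < q <= 1 -> lmi gamma q -> c <= q) ->
  lbound [set q | lmi gamma q /\ qc < q <= 1] c.
Proof. by move=> h q [lq q1]; exact: h. Qed.

Lemma qlmi_le gamma q : qc < q <= 1 -> lmi gamma q -> ql gamma <= q.
Proof.
move=> q1 lq; apply: (@min_or1_le _ _ qc) => //.
by apply: lmi_set_lbound => q' /andP[/ltW].
Qed.

Lemma qlmi_ge gamma c : c <= 1 ->
  (forall q, qc < q <= 1 -> lmi gamma q -> c <= q) -> c <= ql gamma.
Proof. by move=> c1 h; apply: min_or1_ge => //; exact: lmi_set_lbound. Qed.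

Lemma qlmi_le1 gamma : ql gamma <= 1.
Proof.
have [[q [lq q1]]|/min_or1_empty e] :=
  pselect ([set q | lmi gamma q /\ qc < q <= 1] !=set0).
  by apply: le_trans (qlmi_le q1 lq) _; case/andP: q1.
by rewrite /qlmi e.
Qed.

(** LMI feasibility lies between [tr X <= gamma] and [tr X < gamma].  If the two
    optimal values differed, [tr X] would equal [gamma] on an interval between
    them, hence everywhere, and the hypothesis excludes this. *)
Lemma qlmi_qopt gamma : (gamma = f 1 -> trace_nonconstant A C Q V qc) ->
  ql gamma = qo gamma.
Proof.
move=> nc; have /andP[qcm m1] : qc <= qo gamma <= 1 := level_min_itv ft gamma.
apply/le_anti/andP; split; last first.
  apply: qlmi_ge => // q q1 lq; apply: level_min_le; split=> //.
  exact: (lmi_trace Q_pd V_pd crit).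
rewrite leNgt; apply/negP => lt_q; have ql1 := qlmi_le1 gamma.
set a := qo gamma in lt_q qcm m1; set b := ql gamma in lt_q ql1.
pose q := (a + b) / 2; pose q' := (a + q) / 2.
have q1 : qc < q <= 1 by apply/andP; rewrite /q; split; lra.
have aq' : a < q' by rewrite /q' /q; lra.
have q'le1 : q' <= 1 by rewrite /q' /q; lra.
have [fq' q'1] : sublevel qc f gamma q' := level_min_lt ft aq' q'le1.
have qb : q < b by rewrite /q; lra.
have [lt_g|ge_g] := ltP (f q) gamma.
  have := qlmi_le q1 (trace_lmi Q_pd V_pd crit n_gt0 q1 lt_g (lexx _)).
  by rewrite leNgt qb.
have qq' : q' < q by rewrite /q' /q; lra.
have /andP[qcq' _] := q'1; have /andP[_ qle1] := q1.
have anti := tradeoff_anti ft qcq' (ltW qq') qle1.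
have fE : f q = f q' by apply/le_anti; rewrite anti (le_trans fq').
have const := tradeoff_rigid ft qcq' qq' qle1 fE.
have [|s s1 /eqP[]] := nc; last by rewrite (const s s1).
by rewrite -(const q q1); apply/le_anti; rewrite ge_g fE fq'.
Qed.

(** Feasibility is upward closed in [q], so it fails at a midpoint only if that
    point is at most the optimal value. *)
Lemma lmi_bisection_spec gamma k :
  let b := lmi_bisection A C Q V qc gamma k in
  [/\ b.1 <= ql gamma <= b.2, b.2 - b.1 = (1 - qc) / 2 ^+ k
    & (exists2 q, qc < q <= 1 & lmi gamma q) -> lmi gamma b.2].
Proof.
have [/andP[qc0 qc1] _ _ _ _] := ft.
pose P (q : R) := `[< lmi gamma q >].
have [||||low [up sol] _] := bisection_ind (P := P) (Pl := fun a => a <= ql gamma)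
  (Pu := fun b => ql gamma <= b /\
     ((exists2 q, qc < q <= 1 & lmi gamma q) -> lmi gamma b)) qc1 _ _ _ _ k.
- by apply: qlmi_ge => [|q /andP[/ltW]//]; exact: ltW.
- split=> [|[q /andP[qcq q1] lq]]; first exact: qlmi_le1.
  by apply: (lmi_upward Q_pd V_pd _ q1) lq => //; exact: le_trans (ltW qcq).
- move=> m /andP[qcm m1] /asboolP lm; split=> // {k}.
  by apply: qlmi_le; rewrite ?qcm ?ltW.
- move=> m /andP[qcm m1] /asboolP nlm; apply: qlmi_ge => [|q /andP[qcq q1] lq].
    exact: ltW.
  rewrite leNgt; apply/negP => /ltW qm; apply: nlm.
  by apply: (lmi_upward Q_pd V_pd _ qm) lq; [exact: le_trans (ltW qcq) | exact: ltW].
by rewrite /= low up; split=> //; exact: bisection_width.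
Qed.

End Subproblem.

(** * Affine dependence of the constraints *)

Section Affine.
Context {R : realType}.

Lemma convmx_cst m n (t : R) (M : 'M[R]_(m, n)) : t *: M + (1 - t) *: M = M.
Proof. by rewrite -scalerDl addrC subrK scale1r. Qed.

Lemma convmx_block m1 m2 n1 n2 (t : R) (a a' : 'M[R]_(m1, n1))
    (b b' : 'M_(m1, n2)) (c c' : 'M_(m2, n1)) (d d' : 'M_(m2, n2)) :
  t *: block_mx a b c d + (1 - t) *: block_mx a' b' c' d' =
  block_mx (t *: a + (1 - t) *: a') (t *: b + (1 - t) *: b')
           (t *: c + (1 - t) *: c') (t *: d + (1 - t) *: d').
Proof. by rewrite !scale_block_mx add_block_mx. Qed.

Lemma convmx_row m n1 n2 (t : R) (a a' : 'M[R]_(m, n1)) (b b' : 'M_(m, n2)) :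
  t *: row_mx a b + (1 - t) *: row_mx a' b' =
  row_mx (t *: a + (1 - t) *: a') (t *: b + (1 - t) *: b').
Proof. by rewrite !scale_row_mx add_row_mx. Qed.

Lemma convmx_tr m n (t : R) (M M' : 'M[R]_(m, n)) :
  (t *: M + (1 - t) *: M')^T = t *: M^T + (1 - t) *: M'^T.
Proof. by rewrite linearD !linearZ. Qed.

Lemma convmx_mulr m n k (t : R) (M M' : 'M[R]_(m, n)) (B : 'M_(n, k)) :
  (t *: M + (1 - t) *: M') *m B = t *: (M *m B) + (1 - t) *: (M' *m B).
Proof. by rewrite mulmxDl -!scalemxAl. Qed.

Lemma convmx_scale m n (t s : R) (M M' : 'M[R]_(m, n)) :
  s *: (t *: M + (1 - t) *: M') = t *: (s *: M) + (1 - t) *: (s *: M').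
Proof. by rewrite scalerDr !scalerA !(mulrC s). Qed.

Lemma Gamma_affine n p (A : 'M[R]_n) (C : 'M[R]_(p, n)) Q V q : is_affine
  (fun z : 'M[R]_n * 'M[R]_(n, p) * 'M[R]_n => Gamma A C Q V q z.1.1 z.1.2).
Proof.
move=> t [[G H] Y] [[G' H'] Y']; rewrite /Gamma /= -!tr_row_mx.
rewrite !convmx_block !convmx_cst -!convmx_tr !convmx_row -!convmx_scale.
by rewrite !convmx_mulr addrACA -!scalerDr.
Qed.

Lemma coupling_affine n p : is_affine
  (fun z : 'M[R]_n * 'M[R]_(n, p) * 'M[R]_n => coupling z.1.1 z.2).
Proof. by move=> t z z'; rewrite /coupling convmx_block !convmx_cst. Qed.

Lemma trace_affine n p : is_affine
  (fun z : 'M[R]_n * 'M[R]_(n, p) * 'M[R]_n => \tr z.2 : R^o).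
Proof. by move=> t z z'; rewrite mxtraceD !mxtraceZ. Qed.

End Affine.

Theorem theorem14 (R : realType) (N : nat) (n p : 'I_N -> nat)
    (A : forall i, 'M[R]_(n i)) (C : forall i, 'M[R]_(p i, n i))
    (Q : forall i, 'M[R]_(n i)) (V : forall i, 'M[R]_(p i))
    (qc : 'I_N -> R)
    (N_ge1 : (1 <= N)%N)
    (n_ge1 : forall i, (1 <= n i)%N) (p_ge1 : forall i, (1 <= p i)%N)
    (Q_pd : forall i, pd (Q i)) (V_pd : forall i, pd (V i))
    (ctrl : forall i, controllable (A i) (mxsqrt (Q i)))
    (detect : forall i, detectable (A i) (C i))
    (qc_crit : forall i, is_critical_value (A i) (C i) (Q i) (V i) (qc i))
    (sum_qc : \sum_i qc i < 1) :
  let D := OP_feasible qc in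
  let phi := OP_objective A C Q V in
  let opt := OP_value A C Q V qc in
  let E := level_feasible A C Q V qc in
  let m := mu A C Q V qc in
  let bis := mu_bisection A C Q V qc in
  (* OP is a feasible quasi-convex problem, equivalent to its level form *)
  [/\ D !=set0,
      quasiconvex_problem D phi,
      (forall q gamma, is_minimizer E snd (q, gamma) <->
                       is_minimizer D phi q /\ gamma = phi q),
      inf (snd @` E) = opt
    & forall gamma, convex_set [set q | E (q, gamma)]]
  (* bisection on gamma, driving mu to 1, solves OP *)
  /\ [/\ 1 <= m 0 /\ (exists2 u0, 0 < u0 & m u0 < 1),
      (forall l0 u0, 0 <= l0 -> 1 <= m l0 -> m u0 < 1 -> forall k,
        let l := (bis l0 u0 k).1 in
        let u := (bis l0 u0 k).2 in
        [/\ 1 <= m l /\ m u < 1,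
            l <= opt <= u,
            u - l = (u0 - l0) / 2 ^+ k
          & exists q, [/\ D q, phi q <= u
                        & forall i, qopt_vec A C Q V qc u 0 i <= q 0 i]]),
      ((forall i, trace_nonconstant (A i) (C i) (Q i) (V i) (qc i)) ->
        m opt = 1 /\
        forall l0 u0, 0 <= l0 -> 1 <= m l0 -> m u0 < 1 ->
          (fun k => m (bis l0 u0 k).1) @ \oo --> (1 : R) /\
          (fun k => m (bis l0 u0 k).2) @ \oo --> (1 : R)),
      (forall eps, 0 < eps -> exists2 delta, 0 < delta &
        forall gamma, 0 < gamma -> all_sub_feasible A C Q V qc gamma ->
          `|m gamma - 1| <= delta -> `|gamma - opt| <= eps)
    & (forall gamma, 0 < gamma -> all_sub_feasible A C Q V qc gamma ->
        m gamma = 1 ->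
        (forall i, qc i < qopt_vec A C Q V qc gamma 0 i) ->
        is_minimizer D phi (qopt_vec A C Q V qc gamma))]
  (* each subproblem is solved by bisection on q and LMI feasibility *)
  /\ (forall i gamma, 0 < gamma ->
      let sub := sub_feasible (A i) (C i) (Q i) (V i) (qc i) in
      let lmi := lmi_feasible (A i) (C i) (Q i) (V i) in
      let qo := qopt (A i) (C i) (Q i) (V i) (qc i) in
      let ql := qlmi (A i) (C i) (Q i) (V i) (qc i) in
      let qbis := lmi_bisection (A i) (C i) (Q i) (V i) (qc i) gamma in
      (sub gamma !=set0 -> qc i < qo gamma -> sub gamma (qo gamma)) /\
      [/\ ((gamma = trX A C Q V i 1 ->
             trace_nonconstant (A i) (C i) (Q i) (V i) (qc i)) ->
           ql gamma = qo gamma),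
          (forall q, qc i < q <= 1 -> lmi gamma q -> sub gamma q),
          (forall q gamma', gamma < gamma' -> sub gamma q -> lmi gamma' q),
          (forall k,
            [/\ (qbis k).1 <= ql gamma <= (qbis k).2,
                (qbis k).2 - (qbis k).1 = (1 - qc i) / 2 ^+ k
              & (exists2 q, qc i < q <= 1 & lmi gamma q) ->
                lmi gamma (qbis k).2])
        & (let Z := ('M[R]_(n i) * 'M[R]_(n i, p i) * 'M[R]_(n i))%type in
           (* z = (G, H, Y) *)
           [/\ forall q, is_affine (fun z : Z =>
                 Gamma (A i) (C i) (Q i) (V i) q z.1.1 z.1.2),
               is_affine (fun z : Z => coupling z.1.1 z.2)
             & is_affine (fun z : Z => \tr z.2 : R^o)])]).
Proof.
move=> D phi opt E m bis.
have ft i : tradeoff (qc i) (trX A C Q V i).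
  exact: (trace_tradeoff (Q_pd i) (V_pd i) (qc_crit i) (n_ge1 i)).
have mE : mu A C Q V qc = total_min qc (trX A C Q V).
  by apply/funext => gamma; apply: eq_bigr => i _; rewrite mxE.
split; [split | split; [split |]].
- exact: (OP_feasible_nonempty ft).
- exact: (quasiconvex_objective ft).
- exact: (level_minimizerP ft).
- exact: (inf_objective_level ft).
- exact: (objective_level_section_convex ft).
- by rewrite /m mE; split; [exact: total_min0 | exact: (total_min_small ft)].
- move=> l0 u0 _; rewrite /m /bis /mu_bisection mE => ml mu0 k.
  have [ml' mu'] := total_bisection ft ml mu0 k.
  have [q [Dq oq lq]] := total_min_lt1 ft N_ge1 mu'.
  have br := bisection_brackets_opt ft N_ge1 sum_qc k ml mu0.
  split; [by split | exact: br | exact: bisection_width |].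
  by exists q; split=> // i; rewrite mxE; exact: ltW (lq i).
- move=> nc; rewrite /m /bis /mu_bisection mE; split.
    exact: (total_min_opt ft).
  by move=> l0 u0 _; exact: (total_bisection_cvg ft).
- move=> eps eps0; rewrite /m mE.
  have [d d0 near] := total_min_near_opt ft N_ge1 sum_qc eps0.
  by exists d => // gamma _; exact: near.
- move=> gamma _; rewrite /m mE => feas m1 inner.
  apply: (total_min_minimizer ft N_ge1 feas m1) => i.
  by have := inner i; rewrite mxE.
move=> i gamma gamma0 sub lmi qo ql qbis.
split; first exact: (level_min_attained (ft i)).
split.
- exact: (qlmi_qopt (n_ge1 i) (Q_pd i) (V_pd i) (qc_crit i)).
- by move=> q q1 lq; split=> //; exact: (lmi_trace (Q_pd i) (V_pd i) (qc_crit i)).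
- move=> q gamma' lt_g [fq q1].
  exact: (trace_lmi (Q_pd i) (V_pd i) (qc_crit i) (n_ge1 i) q1 lt_g).
- by move=> k; exact: (lmi_bisection_spec (n_ge1 i) (Q_pd i) (V_pd i) (qc_crit i)).
- split; [exact: Gamma_affine | exact: coupling_affine | exact: trace_affine].
Qed.
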